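(* Let $A$ be a finite set. The set of hypotheses $\mathcal{H}_{\mathrm{netkat}}$ over the alphabet $A+P+\{\mathsf{dup}\}$ reduces to the empty set; moreover $\mathsf{KA}_{\mathcal{H}_{\mathrm{netkat}}}$ is complete and the relation $\{(e,f)\mid\mathsf{KA}_{\mathcal{H}_{\mathrm{netkat}}}\vdash e=f\}$ is decidable.
   Context: Regular expressions $T(X)$ over an alphabet $X$: $e,f::=e+f\mid e\cdot f\mid e^*\mid 0\mid 1\mid a$ ($a\in X$), with usual language $\llbracket e\rrbracket$. Kleene algebra axioms: idempotent semiring axioms plus $1+xx^*\le x^*$, $x+yz\le z\Rightarrow y^*x\le z$, $x+yz\le y\Rightarrow xz^*\le y$. A hypothesis is a pair $e\le f$; an equation as hypothesis stands for two inequations. $\mathsf{KA}_H\vdash e=f$ means derivable in equational logic from all instances of the Kleene algebra axioms and the hypotheses in $H$, letters being constants (no substitution rule); $\mathsf{KA}_H\vdash H'$ means all inequations of $H'$ are derivable. The $H$-closure $H^\star(L)$ is the smallest language containing $L$ such that for all $e\le f\in H$ and words $u,v$, $u\llbracket f\rrbracket v\subseteq H^\star(L)$ implies $u\llbracket e\rrbracket v\subseteq H^\star(L)$. $\mathsf{KA}_H$ is complete if $H^\star(\llbracket e\rrbracket)=H^\star(\llbracket f\rrbracket)$ implies $\mathsf{KA}_H\vdash e=f$. For $\Gamma\subseteq\Sigma'$, $H$ over $\Sigma'$, $H'$ over $\Gamma$: $H$ reduces to $H'$ if $\mathsf{KA}_H\vdash H'$ and there is $r:T(\Sigma')\to T(\Gamma)$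 with $\mathsf{KA}_H\vdash e=r(e)$ and $H^\star(\llbracket e\rrbracket)\cap\Gamma^*\subseteq H'^\star(\llbracket r(e)\rrbracket)$ for all $e$; ''reduces to the empty set'' means $H'=\emptyset$ for some such $\Gamma$. $P$ is a disjoint copy of $A$: elements $\alpha\in A$ are atoms, elements $p\in P$ assignments, $p_\alpha\in P$ is the copy of $\alpha$, and $\mathsf{dup}$ is a further letter. $\mathcal{H}_{\mathrm{netkat}}$ consists of the equations $pq=q$ ($p,q\in P$), $p_\alpha\alpha=p_\alpha$, $\alpha p_\alpha=\alpha$, $\alpha\,\mathsf{dup}=\mathsf{dup}\,\alpha$ ($\alpha\in A$), $\sum_{\alpha\in A}\alpha=1$, and $\alpha\beta=0$ ($\alpha,\beta\in A$, $\alpha\neq\beta$). *)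

(* Defs.v *)
From mathcomp Require Import all_boot.
Set Implicit Arguments.
Unset Strict Implicit.
Unset Printing Implicit Defensive.

(** * Regular expressions and languages *)

Inductive term (X : Type) : Type :=
  | Zero
  | One
  | Letter of X
  | Plus of term X & term X
  | Dot of term X & term X
  | Star of term X.
Arguments Zero {X}.
Arguments One {X}.

Declare Scope term_scope.
Delimit Scope term_scope with term.
Bind Scope term_scope with term.
Notation "0" := Zero : term_scope.
Notation "1" := One : term_scope.
Notation "e + f" := (Plus e f) : term_scope.
Notation "e * f" := (Dot e f) : term_scope.
Notation "e ^*" := (Star e) : term_scope.

Fixpoint map_term (X Y : Type) (h : X -> Y) (e : term X) : term Y :=
  match e with
  | Zero => 0
  | One => 1
  | Letter x => Letter (h x)
  | Plus e1 e2 => map_term h e1 + map_term h e2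
  | Dot e1 e2 => map_term h e1 * map_term h e2
  | Star e1 => (map_term h e1)^*
  end%term.

Definition language (X : Type) := seq X -> Prop.

Inductive star_lang (X : Type) (L : language X) : language X :=
  | star_nil : star_lang L [::]
  | star_cons u v : L u -> star_lang L v -> star_lang L (u ++ v).

Fixpoint lang (X : Type) (e : term X) : language X :=
  match e with
  | Zero => fun _ => False
  | One => fun w => w = [::]
  | Letter x => fun w => w = [:: x]
  | Plus e1 e2 => fun w => lang e1 w \/ lang e2 w
  | Dot e1 e2 => fun w => exists u v, [/\ w = u ++ v, lang e1 u & lang e2 v]
  | Star e1 => star_lang (lang e1)
  end.

(** * Kleene algebra with hypotheses *)

(* [H e f] means that the inequation e <= f belongs to H. *)
Definition hypotheses (X : Type) := term X -> term X -> Prop.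

Definition no_hypotheses (X : Type) : hypotheses X := fun _ _ => False.

Definition hyps_of_equations (X : Type) (E : term X -> term X -> Prop) :
    hypotheses X :=
  fun e f => E e f \/ E f e.

Reserved Notation "H ⊢ e ≡ f" (at level 70, e at next level, f at next level).
Reserved Notation "H ⊢ e ≦ f" (at level 70, e at next level, f at next level).

(* Letters are constants: there is no substitution rule. *)
Inductive ka_eq (X : Type) (H : hypotheses X) : term X -> term X -> Prop :=
  | ka_refl e : H ⊢ e ≡ e
  | ka_sym e f : H ⊢ e ≡ f -> H ⊢ f ≡ e
  | ka_trans e f g : H ⊢ e ≡ f -> H ⊢ f ≡ g -> H ⊢ e ≡ g
  | ka_plus_cong e e' f f' : H ⊢ e ≡ e' -> H ⊢ f ≡ f' -> H ⊢ e + f ≡ e' + f'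
  | ka_dot_cong e e' f f' : H ⊢ e ≡ e' -> H ⊢ f ≡ f' -> H ⊢ e * f ≡ e' * f'
  | ka_star_cong e e' : H ⊢ e ≡ e' -> H ⊢ e^* ≡ e'^*
  | ka_plusA x y z : H ⊢ x + (y + z) ≡ (x + y) + z
  | ka_plusC x y : H ⊢ x + y ≡ y + x
  | ka_plus0 x : H ⊢ x + 0 ≡ x
  | ka_plusxx x : H ⊢ x + x ≡ x
  | ka_dotA x y z : H ⊢ x * (y * z) ≡ (x * y) * z
  | ka_dot1x x : H ⊢ 1 * x ≡ x
  | ka_dotx1 x : H ⊢ x * 1 ≡ x
  | ka_dot0x x : H ⊢ 0 * x ≡ 0
  | ka_dotx0 x : H ⊢ x * 0 ≡ 0
  | ka_dotDr x y z : H ⊢ x * (y + z) ≡ x * y + x * z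
  | ka_dotDl x y z : H ⊢ (x + y) * z ≡ x * z + y * z
  | ka_star_unfold x : H ⊢ 1 + x * x^* ≦ x^*
  | ka_star_indl x y z : H ⊢ x + y * z ≦ z -> H ⊢ y^* * x ≦ z
  | ka_star_indr x y z : H ⊢ x + y * z ≦ y -> H ⊢ x * z^* ≦ y
  | ka_hyp e f : H e f -> H ⊢ e ≦ f
where "H ⊢ e ≡ f" := (ka_eq H e%term f%term)
and "H ⊢ e ≦ f" := (ka_eq H (Plus e%term f%term) f%term).

(* The premise of [closure_step] is u⟦f⟧v ⊆ H*(L), its conclusion
   u⟦e⟧v ⊆ H*(L). *)
Inductive closure (X : Type) (H : hypotheses X) (L : language X) : language X :=
  | closure_incl w : L w -> closure H L w
  | closure_step e f u v : H e f ->
      (forall w, lang f w -> closure H L (u ++ w ++ v)) ->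
      forall w, lang e w -> closure H L (u ++ w ++ v).

Definition ka_complete (X : Type) (H : hypotheses X) : Prop :=
  forall e f : term X,
    (forall w, closure H (lang e) w <-> closure H (lang f) w) -> H ⊢ e ≡ f.

(* The subalphabet is the subtype {x | G x}; its terms and words are included
   in those over X along [sval]. *)
Definition reduces (X : Type) (H : hypotheses X) (G : pred X)
    (H' : hypotheses {x : X | G x}) : Prop :=
  (forall e f, H' e f -> H ⊢ map_term sval e ≦ map_term sval f) /\
  exists r : term X -> term {x : X | G x},
    (forall e, H ⊢ e ≡ map_term sval (r e)) /\
    (forall e w, closure H (lang e) (map sval w) -> closure H' (lang (r e)) w).

Definition reduces_to_empty (X : Type) (H : hypotheses X) : Prop :=
  exists G : pred X, reduces H (@no_hypotheses {x : X | G x}).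

(** * Decidability *)

(* A function into [bool] or [sumbool] would not express decidability in the
   presence of classical choice axioms, so computability is made explicit. This
   is the usual class of total recursive functions, generated by composition,
   primitive recursion and minimization of regular functions (in [rec_min],
   regularity of g is witnessed by f itself). *)
Inductive recursive : forall n, (n.-tuple nat -> nat) -> Prop :=
  | rec_zero n : recursive (fun _ : n.-tuple nat => 0)
  | rec_succ : recursive (fun v : 1.-tuple nat => (tnth v ord0).+1)
  | rec_proj n (i : 'I_n) : recursive (fun v : n.-tuple nat => tnth v i)
  | rec_comp m n (g : m.-tuple nat -> nat) (h : 'I_m -> n.-tuple nat -> nat)
      (f : n.-tuple nat -> nat) :
      recursive g -> (forall i, recursive (h i)) ->
      (forall v, f v = g [tuple h i v | i < m]) ->
      recursive f
  | rec_prim n (g : n.-tuple nat -> nat) (h : n.+2.-tuple nat -> nat)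
      (f : n.+1.-tuple nat -> nat) :
      recursive g -> recursive h ->
      (forall v : n.-tuple nat, f [tuple of 0 :: v] = g v) ->
      (forall x (v : n.-tuple nat), f [tuple of x.+1 :: v] =
                   h [tuple of x :: f [tuple of x :: v] :: v]) ->
      recursive f
  | rec_min n (g : n.+1.-tuple nat -> nat) (f : n.-tuple nat -> nat) :
      recursive g ->
      (forall v : n.-tuple nat, g [tuple of f v :: v] = 0) ->
      (forall (v : n.-tuple nat) y, y < f v -> g [tuple of y :: v] <> 0) ->
      recursive f.

(* Cantor's pairing function: (x + y)(x + y + 1)/2 + y. *)
Definition pair_code (x y : nat) : nat := 'C((x + y).+1, 2) + y.

(* A Gödel numbering of terms. *)
Fixpoint term_code (X : finType) (e : term X) : nat :=
  match e with
  | Zero => pair_code 0 0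
  | One => pair_code 1 0
  | Letter x => pair_code 2 (enum_rank x)
  | Plus e1 e2 => pair_code 3 (pair_code (term_code e1) (term_code e2))
  | Dot e1 e2 => pair_code 4 (pair_code (term_code e1) (term_code e2))
  | Star e1 => pair_code 5 (term_code e1)
  end.

Definition decidable_relation (X : finType) (R : term X -> term X -> Prop) :
    Prop :=
  exists d : 2.-tuple nat -> nat, recursive d /\
    forall e f, R e f <-> d [tuple term_code e; term_code f] = 1.

(** * NetKAT *)

(* The three summands are the atoms, the disjoint copy P of the atoms, and
   dup. *)
Definition netkat_letter (A : finType) : finType := (A + A + unit)%type.

Definition atom (A : finType) (a : A) : term (netkat_letter A) :=
  Letter (inl (inl a) : netkat_letter A).
Definition assign (A : finType) (a : A) : term (netkat_letter A) :=
  Letter (inl (inr a) : netkat_letter A).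
Definition dup (A : finType) : term (netkat_letter A) :=
  Letter (inr tt : netkat_letter A).

Inductive netkat_equations (A : finType) :
    term (netkat_letter A) -> term (netkat_letter A) -> Prop :=
  | nk_assign_assign (a b : A) :
      netkat_equations (assign a * assign b) (assign b)
  | nk_assign_atom (a : A) : netkat_equations (assign a * atom a) (assign a)
  | nk_atom_assign (a : A) : netkat_equations (atom a * assign a) (atom a)
  | nk_atom_dup (a : A) : netkat_equations (atom a * dup A) (dup A * atom a)
  | nk_sum_atoms :
      netkat_equations (\big[@Plus (netkat_letter A)/Zero]_(a : A) atom a) 1
  | nk_atom_atom (a b : A) : a <> b -> netkat_equations (atom a * atom b) 0.

Definition H_netkat (A : finType) : hypotheses (netkat_letter A) :=
  hyps_of_equations (@netkat_equations A).
Arguments H_netkat A _ _ : clear implicits.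

(* Main.v *)
(** NetKAT terms act on pairs (output still to be produced, current packet): an
    atom filters, an assignment sets the packet, and [dup] emits it. This is a
    model of the hypotheses, so closure preserves the behaviour of a language.

    Conversely, provability of [e <= f] can be read off a deterministic automaton:
    if it accepts every word of [e] and terms [y q] solve its linear system from
    below, then [e <= y q0]. Words on states give terms [S p q] by Kleene's
    construction; by induction on [e], [S p q * e] is below the sum of the [S p q']
    with [q'] reachable from [q] along a word of [e], and leastness bounds
    [S q0 q' * y q'] by [y q0]. For NetKAT the states are a packet together with a
    set of partial derivatives of [f] by [dup], each guarded by an assignment. So
    behavioural inclusion implies provable inclusion, which gives completeness;
    the reduction keeps the whole alphabet and sends [e] to a term for the regular
    language of the words whose behaviour is included in that of [e].

    The number of states bounds the length of a word on which two inequivalent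
    terms differ, hence equivalence can be tested on finite relational models of a
    computable size. Relations are stored as bit masks, and terms are evaluated by
    course-of-values recursion on their codes. *)

Require Import Defs.
From Stdlib Require Import Morphisms.
From HB Require Import structures.
From mathcomp Require Import all_boot boolp.
Set Implicit Arguments.
Unset Strict Implicit.
Unset Printing Implicit Defensive.

(* The derivable order of Kleene algebra and its finite sums *)
#[global] Hint Resolve ka_refl : core.

#[global] Instance ka_eq_equivalence (X : Type) (H : hypotheses X) :
  Equivalence (ka_eq H).
Proof.
by split=> [e|e f|e f g]; [apply: ka_refl | apply: ka_sym | apply: ka_trans].
Qed.

#[global] Instance Plus_proper (X : Type) (H : hypotheses X) :
  Proper (ka_eq H ==> ka_eq H ==> ka_eq H) (@Plus X).
Proof. by move=> e e' He f f' Hf; apply: ka_plus_cong. Qed.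

#[global] Instance Dot_proper (X : Type) (H : hypotheses X) :
  Proper (ka_eq H ==> ka_eq H ==> ka_eq H) (@Dot X).
Proof. by move=> e e' He f f' Hf; apply: ka_dot_cong. Qed.

#[global] Instance Star_proper (X : Type) (H : hypotheses X) :
  Proper (ka_eq H ==> ka_eq H) (@Star X).
Proof. by move=> e e'; apply: ka_star_cong. Qed.

Section Order.
Variables (X : Type) (H : hypotheses X).
Implicit Types e f g x y z : term X.

Lemma kle_eq e f : H ⊢ e ≡ f -> H ⊢ e ≦ f.
Proof. by move=> ->; apply: ka_plusxx. Qed.

Lemma kle_refl e : H ⊢ e ≦ e.
Proof. exact: ka_plusxx. Qed.

Lemma kle_trans f e g : H ⊢ e ≦ f -> H ⊢ f ≦ g -> H ⊢ e ≦ g.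
Proof. by move=> ef fg; rewrite -fg ka_plusA ef. Qed.

Lemma kle_anti e f : H ⊢ e ≦ f -> H ⊢ f ≦ e -> H ⊢ e ≡ f.
Proof. by move=> ef fe; rewrite -ef -{1}fe ka_plusC. Qed.

Lemma kle_plusl e f : H ⊢ e ≦ e + f.
Proof. by rewrite ka_plusA ka_plusxx. Qed.

Lemma kle_plusr e f : H ⊢ f ≦ e + f.
Proof. by rewrite (ka_plusC _ e f); apply: kle_plusl. Qed.

Lemma kle_lub e f g : H ⊢ e ≦ g -> H ⊢ f ≦ g -> H ⊢ e + f ≦ g.
Proof. by move=> eg fg; rewrite -ka_plusA fg. Qed.

Lemma kle_0 e : H ⊢ 0 ≦ e.
Proof. by rewrite ka_plusC ka_plus0. Qed.

Lemma kle_dotr e f g : H ⊢ e ≦ f -> H ⊢ g * e ≦ g * f.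
Proof. by move=> ef; rewrite -ka_dotDr ef. Qed.

Lemma kle_dotl e f g : H ⊢ e ≦ f -> H ⊢ e * g ≦ f * g.
Proof. by move=> ef; rewrite -ka_dotDl ef. Qed.

Lemma kle_dot e e' f f' : H ⊢ e ≦ e' -> H ⊢ f ≦ f' -> H ⊢ e * f ≦ e' * f'.
Proof. by move=> ee ff; apply: kle_trans (kle_dotr _ ff); apply: kle_dotl. Qed.

Lemma kle_assoc x e f g : H ⊢ x ≦ e * f * g -> H ⊢ x ≦ e * (f * g).
Proof. by rewrite ka_dotA. Qed.

Lemma kle_mulr e f : H ⊢ 1 ≦ f -> H ⊢ e ≦ e * f.
Proof.
by move=> f1; apply: kle_trans (kle_dotr e f1); apply: kle_eq; rewrite ka_dotx1.
Qed.

Lemma kle_mull e f : H ⊢ 1 ≦ f -> H ⊢ e ≦ f * e.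
Proof.
by move=> f1; apply: kle_trans (kle_dotl e f1); apply: kle_eq; rewrite ka_dot1x.
Qed.

Lemma kle_star1 e : H ⊢ 1 ≦ e^*.
Proof. exact: kle_trans (kle_plusl _ _) (ka_star_unfold _ _). Qed.

Lemma kle_star_unfold e : H ⊢ e * e^* ≦ e^*.
Proof. exact: kle_trans (kle_plusr _ _) (ka_star_unfold _ _). Qed.

Lemma kle_star e : H ⊢ e ≦ e^*.
Proof.
apply: kle_trans (kle_star_unfold e).
exact/kle_mulr/kle_star1.
Qed.

Lemma kle_starl y z : H ⊢ y * z ≦ z -> H ⊢ y^* * z ≦ z.
Proof. by move=> yz; apply: ka_star_indl; apply: kle_lub => //; apply: kle_refl. Qed.

Lemma kle_starr y z : H ⊢ y * z ≦ y -> H ⊢ y * z^* ≦ y.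
Proof. by move=> yz; apply: ka_star_indr; apply: kle_lub => //; apply: kle_refl. Qed.

Lemma kle_star_star e : H ⊢ e^* * e^* ≦ e^*.
Proof. exact/kle_starl/kle_star_unfold. Qed.

Variable I : Type.
Implicit Types (r : seq I) (P : pred I) (F : I -> term X).

Lemma sum_lub r P F g : (forall i, P i -> H ⊢ F i ≦ g) ->
  H ⊢ \big[@Plus X/Zero]_(i <- r | P i) F i ≦ g.
Proof.
move=> Fg; elim/big_rec: _ => [|i x Pi xg]; first exact: kle_0.
by apply: kle_lub => //; apply: Fg.
Qed.

Lemma dot_sum_lub r P F x g : (forall i, P i -> H ⊢ x * F i ≦ g) ->
  H ⊢ x * \big[@Plus X/Zero]_(i <- r | P i) F i ≦ g.
Proof.
move=> Fg; elim/big_rec: _ => [|i y Pi xg]; first by rewrite ka_dotx0; apply: kle_0.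
by rewrite ka_dotDr; apply: kle_lub => //; apply: Fg.
Qed.

Lemma sum_dot_lub r P F x g : (forall i, P i -> H ⊢ F i * x ≦ g) ->
  H ⊢ (\big[@Plus X/Zero]_(i <- r | P i) F i) * x ≦ g.
Proof.
move=> Fg; elim/big_rec: _ => [|i y Pi xg]; first by rewrite ka_dot0x; apply: kle_0.
by rewrite ka_dotDl; apply: kle_lub => //; apply: Fg.
Qed.

End Order.

Lemma sum_ub (X : Type) (H : hypotheses X) (I : finType) (P : pred I)
    (F : I -> term X) i :
  P i -> H ⊢ F i ≦ \big[@Plus X/Zero]_(j | P j) F j.
Proof.
move=> Pi; have : i \in index_enum I by rewrite mem_index_enum.
elim: (index_enum I) => // j r IH; rewrite inE big_cons.
case/orP => [/eqP<- | /IH ler]; first by rewrite Pi; apply: kle_plusl.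
by case: ifP => // _; apply: kle_trans ler _; apply: kle_plusr.
Qed.

Definition top_term (X : finType) : term X :=
  Star (\big[@Plus X/Zero]_x Letter x).

(** The star of all letters absorbs products on the right, as [x^* * x^*] is below [x^*]; this
    settles products directly and stars by star induction. *)
Lemma kle_top (X : finType) (H : hypotheses X) e : H ⊢ e ≦ top_term X.
Proof.
have topD f : H ⊢ f ≦ top_term X -> H ⊢ f * top_term X ≦ top_term X.
  by move=> le; apply: kle_trans (kle_star_star _ _); apply: kle_dotl.
elim: e => [||x|e IHe f IHf|e IHe f IHf|e IHe].
- exact: kle_0.
- exact: kle_star1.
- apply: kle_trans (kle_star _ _).
  exact: (@sum_ub _ _ _ _ (@Letter X)).
- exact: kle_lub.
- by apply: kle_trans (topD _ IHe); apply: kle_dotr.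
- apply: kle_trans (kle_starl (topD _ IHe)).
  exact/kle_mulr/kle_star1.
Qed.

Inductive rtc (Q : Type) (R : Q -> Q -> Prop) : Q -> Q -> Prop :=
  | rtc_refl s : rtc R s s
  | rtc_step s t u : R s t -> rtc R t u -> rtc R s u.

Lemma lang_star1 (X : Type) (e : term X) w : lang e w -> lang e^*%term w.
Proof.
by move=> ew; rewrite -[w]cats0; apply: star_cons => //; apply: star_nil.
Qed.

(** * Relational models *)

Section RelationalModels.
Variables (X Q : Type) (V : X -> Q -> Q -> Prop).

Fixpoint eval (e : term X) : Q -> Q -> Prop :=
  match e with
  | Zero => fun _ _ => False
  | One => fun s t => s = t
  | Letter x => V x
  | Plus e1 e2 => fun s t => eval e1 s t \/ eval e2 s t
  | Dot e1 e2 => fun s t => exists2 u, eval e1 s u & eval e2 u t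
  | Star e1 => rtc (eval e1)
  end.

Fixpoint run (w : seq X) (s t : Q) : Prop :=
  if w is x :: w' then exists2 u, V x s u & run w' u t else s = t.

Lemma run_cat w w' s t : run (w ++ w') s t <-> exists2 u, run w s u & run w' u t.
Proof.
elim: w s => [|x w IH] s /=; first by split=> [|[_ <-] //]; exists s.
split=> [[u Vu /IH[v]] | [v [u Vu uv] vt]]; first by exists v => //; exists u.
by exists u => //; apply/IH; exists v.
Qed.

(** Ties relational semantics to languages, so that statements about terms can be checked on single
    words. *)
Lemma evalP e s t : eval e s t <-> exists2 w, lang e w & run w s t.
Proof.
elim: e s t => [||x|e1 IH1 e2 IH2|e1 IH1 e2 IH2|e1 IH1] s t /=.
- by split=> // -[].
- by split=> [->|[w ->]] //; exists [::].
- by split=> [Vst|[w -> [u Vu <-]]] //; exists [:: x] => //; exists t.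
- split=> [[/IH1|/IH2] [w ew wst] | [w [ew|ew] wst]].
  + by exists w => //; left.
  + by exists w => //; right.
  + by left; apply/IH1; exists w.
  + by right; apply/IH2; exists w.
- split=> [[u /IH1[w ew wsu] /IH2[w' ew' wut]]
          |[_ [w [w' [-> ew ew']]] /run_cat[u wsu wut]]].
  + by exists (w ++ w'); [exists w, w' | apply/run_cat; exists u].
  + by exists u; [apply/IH1; exists w | apply/IH2; exists w'].
- split=> [|[w ew]].
    elim=> [{}s|{}s u {}t /IH1[w ew wsu] _ [w' ew' wut]].
      by exists [::]; first exact: star_nil.
    by exists (w ++ w'); [apply: star_cons | apply/run_cat; exists u].
  elim: ew s => [|w1 w2 ew1 _ IH] s; first by move=> /= <-; apply: rtc_refl.
  case/run_cat=> u su /IH; apply: rtc_step.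
  by apply/IH1; exists w1.
Qed.

Lemma eval_sum (I : finType) (F : I -> term X) s t :
  eval (\big[@Plus X/Zero]_i F i) s t <-> exists i, eval (F i) s t.
Proof.
split=> [|[i]].
  by elim/big_rec: _ => //= i y _ IH [Fi|/IH //]; exists i.
have : i \in index_enum I by rewrite mem_index_enum.
elim: (index_enum I) => // j r IH; rewrite inE big_cons /=.
by case/orP => [/eqP<- | /IH ler Fi]; [left | right; apply: ler].
Qed.

Definition satisfies (H : hypotheses X) : Prop :=
  forall e f, H e f -> forall s t, eval e s t -> eval f s t.

Lemma ka_eq_sound H e f : satisfies H -> H ⊢ e ≡ f ->
  forall s t, eval e s t <-> eval f s t.
Proof.
move=> satH; elim=> {e f}.
- by [].
- by move=> e f _ IH s t; rewrite IH.
- by move=> e f g _ IH _ IH' s t; rewrite IH.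
- by move=> e e' f f' _ IH _ IH' s t /=; rewrite IH IH'.
- by move=> e e' f f' _ IH _ IH' s t /=; split=> -[u];
    [rewrite IH IH' | rewrite -IH -IH']; exists u.
- by move=> e e' _ IH s t /=; split; elim=> [?|??? /IH ? _]; 
    by [apply: rtc_refl | apply: rtc_step].
- by move=> x y z s t /=; tauto.
- by move=> x y s t /=; tauto.
- by move=> x s t /=; tauto.
- by move=> x s t /=; tauto.
- move=> x y z s t /=; split=> [[u xu [v yv zt]]|[v [u xu yv] zt]].
    by exists v => //; exists u.
  by exists u => //; exists v.
- by move=> x s t /=; split=> [[_ <-]|]; last by exists s.
- by move=> x s t /=; split=> [[u ? <-]|]; last by exists t.
- by move=> x s t /=; split=> // -[].
- by move=> x s t /=; split=> // -[].
- by move=> x y z s t /=; split=> [[u xu []]|[[u]|[u]]]; [left|right|..];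
    exists u => //; [left|right].
- by move=> x y z s t /=; split=> [[u []]|[[u]|[u]]]; [left|right|..];
    try exists u => //; [left|right].
- move=> x s t /=; split=> [[[->|[u su ut]]|//]|]; last by right.
    exact: rtc_refl.
  exact: rtc_step ut.
- move=> x y z _ IH s t /=; split=> [[[u su ut]|//]|]; last by right.
  by elim: su ut => [v|v w w' vw _ IHw /IHw wt]; [|]; 
    [move=> xv; apply/IH; left; left | apply/IH; left; right; exists w].
- move=> x y z _ IH s t /=; split=> [[[u su ut]|//]|]; last by right.
  have {}su : eval y s u by apply/IH; left; left.
  elim: ut su => // v w w' vw _ IHw sv; apply: IHw.
  by apply/IH; left; right; exists v.
- by move=> e f /satH ef s t /=; split=> [[/ef|]|]; last by right.
Qed.

Lemma ka_le_sound H e f s t : satisfies H -> H ⊢ e ≦ f ->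
  eval e s t -> eval f s t.
Proof. by move=> satH /(ka_eq_sound satH)-/(_ s t)<- est; left. Qed.

End RelationalModels.

(** [h] is a functional bisimulation: whatever is reached from [h s] is again some [h t], so the
    match for letters passes to products and, step by step, to stars. *)
Lemma eval_bisim (X Q Q' : Type) (V : X -> Q -> Q -> Prop)
    (V' : X -> Q' -> Q' -> Prop) (h : Q -> Q') :
  (forall x s t', V' x (h s) t' <-> exists2 t, V x s t & t' = h t) ->
  forall e s t', eval V' e (h s) t' <-> exists2 t, eval V e s t & t' = h t.
Proof.
move=> hV; elim=> [||x|e1 IH1 e2 IH2|e1 IH1 e2 IH2|e1 IH1] s t' /=.
- by split=> // -[].
- by split=> [<-|[t <- ->]] //; exists s.
- exact: hV.
- split=> [[/IH1|/IH2] [t]|[t [st|st]]]; try by exists t; [left|].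
  + by exists t; [right|].
  + by left; apply/IH1; exists t.
  + by right; apply/IH2; exists t.
- split=> [[u' /IH1[u su ->] /IH2[t ut ->]]|[t [u su ut] ->]].
    by exists t => //; exists u.
  by exists (h u); [apply/IH1; exists u | apply/IH2; exists t].
- split=> [|[t st ->]].
    move Es: (h s) => s' st; elim: st s Es => [{}s' s <-|a b c ab _ IH s Es].
      by exists s => //; apply: rtc_refl.
    move: ab; rewrite -Es => /IH1[t st Eb].
    by have [u tu ->] := IH t (esym Eb); exists u => //; apply: rtc_step tu.
  elim: st => [u|u v w uv _]; first exact: rtc_refl.
  by apply: rtc_step; apply/IH1; exists v.
Qed.

Lemma lang_sound (X : Type) (e f : term X) w :
  @no_hypotheses X ⊢ e ≦ f -> lang e w -> lang f w.
Proof.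
(* States are words and a letter consumes the head, so the runs from [w] to the empty word spell
   exactly [w]. *)
move=> ef ew; pose V (x : X) u v := u = x :: v.
have runV u s t : run V u s t <-> s = u ++ t.
  elim: u s => [|x u IH] s /=; first by split.
  by split=> [[_ -> /IH->]|->] //; exists (u ++ t) => //; apply/IH.
have : eval V e w [::] by apply/evalP; exists w => //; apply/runV; rewrite cats0.
by move/(ka_le_sound (fun _ _ F => False_ind _ F) ef)/evalP => [u fu /runV->]; rewrite cats0.
Qed.

Lemma lang_sum (X : Type) (I : finType) (P : pred I) (F : I -> term X) w :
  lang (\big[@Plus X/Zero]_(i | P i) F i) w <-> exists2 i, P i & lang (F i) w.
Proof.
split=> [|[i Pi]].
  by elim/big_rec: _ => //= i y Pi IH [Fi|/IH //]; exists i.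
exact/lang_sound/sum_ub.
Qed.

Lemma lang_map (X Y : Type) (h : X -> Y) (e : term X) w :
  lang e w -> lang (map_term h e) (map h w).
Proof.
elim: e w => [||x|e1 IH1 e2 IH2|e1 IH1 e2 IH2|e1 IH1] w //=.
- by move->.
- by move->.
- by case=> [/IH1|/IH2]; [left|right].
- case=> u [v [-> /IH1 eu /IH2 ev]]; exists (map h u), (map h v).
  by rewrite map_cat.
- elim=> [|u v /IH1 eu _ IH]; first exact: star_nil.
  by rewrite map_cat; apply: star_cons.
Qed.

Lemma map_term_comp (X Y Z : Type) (h : X -> Y) (k : Y -> Z) (e : term X) :
  map_term k (map_term h e) = map_term (k \o h) e.
Proof. by elim: e => //= [e1 -> e2 ->|e1 -> e2 ->|e1 ->]. Qed.

Lemma map_term_id (X : Type) (h : X -> X) (e : term X) :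
  h =1 id -> map_term h e = e.
Proof. by move=> h1; elim: e => //= [x|e1 -> e2 ->|e1 -> e2 ->|e1 ->] //; rewrite h1. Qed.

(** * Automata *)

Section Automata.
Variables (X Q : finType) (delta : Q -> X -> Q).

(* McNaughton-Yamada: the words leading from [p] to [q] with intermediate states
   in [c]. *)
Fixpoint paths (c : seq Q) (p q : Q) : term X :=
  if c is k :: c' then
    (paths c' p q + paths c' p k * ((paths c' k k)^* * paths c' k q))%term
  else ((if p == q then 1 else 0)
        + \big[@Plus X/Zero]_(x | delta p x == q) Letter x)%term.

Lemma paths_cons k c p q : paths (k :: c) p q =
  (paths c p q + paths c p k * ((paths c k k)^* * paths c k q))%term.
Proof. by []. Qed.

Lemma lang_paths_sub c p q w : lang (paths c p q) w -> foldl delta p w = q.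
Proof.
elim: c p q w => [|k c IH] p q w /=.
  case=> [|/lang_sum[x /eqP<- ->] //]; by case: eqP => //= <- ->.
case=> [/IH //|[u [v [-> /IH pk [v1 [v2 [-> kk /IH kq]]]]]]].
rewrite !foldl_cat pk; suff -> : foldl delta k v1 = k by [].
by elim: kk => // u1 u2 /IH ku _; rewrite foldl_cat ku.
Qed.

Variable H : hypotheses X.

Lemma paths_one c p : H ⊢ 1 ≦ paths c p p.
Proof.
elim: c => [|k c IH] /=; first by rewrite eqxx; apply: kle_plusl.
by apply: kle_trans IH _; apply: kle_plusl.
Qed.

Lemma paths_letter c p x : H ⊢ Letter x ≦ paths c p (delta p x).
Proof.
elim: c => [|k c IH] /=.
  apply: kle_trans (kle_plusr _ _ _).
  exact: (@sum_ub _ _ _ (fun y => delta p y == delta p x)).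
by apply: kle_trans IH _; apply: kle_plusl.
Qed.

(** If the middle state is the head of the list, both factors are absorbed into the starred loop at
    it. Otherwise both factors are unfolded and the four products are bounded by induction. *)
Lemma paths_dot c k p q : k \in c -> H ⊢ paths c p k * paths c k q ≦ paths c p q.
Proof.
elim: c k p q => // k c IH k' p q; rewrite inE.
have [-> _|_ k'c] := eqVneq k' k.
  have half1 r : H ⊢ paths (k :: c) r k ≦ paths c r k * (paths c k k)^*.
    rewrite paths_cons; apply: kle_lub.
      exact/kle_mulr/kle_star1.
    apply: kle_dotr; apply: kle_trans (kle_star_star _ _).
    apply: kle_dotr; apply: kle_star.
  have half2 r : H ⊢ paths (k :: c) k r ≦ (paths c k k)^* * paths c k r.
    rewrite paths_cons; apply: kle_lub.
      exact/kle_mull/kle_star1.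
    by rewrite ka_dotA; apply: kle_dotl; apply: kle_star_unfold.
  apply: kle_trans (kle_dot (half1 p) (half2 q)) _.
  apply: kle_trans (kle_plusr _ (paths c p q) _).
  rewrite -ka_dotA; apply: kle_dotr; rewrite ka_dotA.
  apply: kle_dotl; apply: kle_star_star.
rewrite !paths_cons ka_dotDl 2!ka_dotDr; apply: kle_lub; apply: kle_lub.
- by apply: kle_trans (kle_plusl _ _ _); apply: IH.
- apply: kle_trans (kle_plusr _ _ _); rewrite ka_dotA.
  apply: kle_dotl; exact: IH.
- apply: kle_trans (kle_plusr _ _ _); rewrite -!ka_dotA.
  by do 2!apply: kle_dotr; exact: IH.
- apply: kle_trans (kle_plusr _ _ _); rewrite -!ka_dotA.
  apply: kle_dotr.
  (* Both factors detour through [k]: the stretch from [k] over [k'] back to [k] is one more loop at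
     [k], absorbed by the star. *)
  apply: (@kle_trans _ _ ((paths c k k)^* * (paths c k k)^* * paths c k q)).
    rewrite -!ka_dotA; apply: kle_dotr.
    rewrite ka_dotA; apply: kle_trans (kle_dotl _ (IH _ _ _ k'c)) _.
    by rewrite ka_dotA; apply: kle_dotl; apply: kle_star_unfold.
  apply: kle_dotl; apply: kle_star_star.
Qed.

(** Loops at [k] send [y k] below itself, hence so does their star; this star induction is where
    leastness enters. *)
Lemma paths_least c (y : Q -> term X) :
  (forall q x, H ⊢ Letter x * y (delta q x) ≦ y q) ->
  forall p q, H ⊢ paths c p q * y q ≦ y p.
Proof.
move=> ydelta; elim: c => [|k c IH] p q /=; rewrite ka_dotDl; apply: kle_lub.
- case: eqP => [->|_]; first by rewrite ka_dot1x; apply: kle_refl.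
  by rewrite ka_dot0x; apply: kle_0.
- by apply: sum_dot_lub => x /eqP<-.
- exact: IH.
- rewrite -!ka_dotA; apply: kle_trans (IH p k); apply: kle_dotr.
  apply: kle_trans (kle_dotr _ (IH k q)) _.
  exact/kle_starl/IH.
Qed.

Notation S := (paths (enum Q)).

(* Summing over the states reached, instead of solving the system backwards, is
   what makes the star case work: the latter would need meets. *)
Lemma paths_reach p q e z :
  (forall w, lang e w -> H ⊢ S p (foldl delta q w) ≦ z) -> H ⊢ S p q * e ≦ z.
Proof.
pose reach q e := \big[@Plus X/Zero]_(q' |
  `[< exists2 w, lang e w & foldl delta q w = q' >]) S p q'.
have reach_ub r g w : lang g w -> H ⊢ S p (foldl delta r w) ≦ reach r g.
  by move=> gw; apply: (@sum_ub _ _ _ _ (S p)); apply/asboolP; exists w.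
elim: e q z => [||x|e IHe f IHf|e IHe f IHf|e IHe] q z ez.
- by rewrite ka_dotx0; apply: kle_0.
- by rewrite ka_dotx1; apply: (ez [::]).
- apply: kle_trans (ez [:: x] erefl).
  apply: kle_trans (kle_dotr _ (paths_letter (enum Q) q x)) _.
  by apply: paths_dot; rewrite mem_enum.
- by rewrite ka_dotDr; apply: kle_lub; [apply: IHe|apply: IHf] => w ew; apply: ez;
    [left|right].
- rewrite ka_dotA; apply: kle_trans (kle_dotl _ (IHe _ (reach q e) _)) _.
    exact: reach_ub.
  apply: sum_dot_lub => _ /asboolP[u eu <-]; apply: IHf => v fv.
  by rewrite -foldl_cat; apply: ez; exists u, v.
- apply: (@kle_trans _ _ (reach q e^*%term)); last first.
    by apply: sum_lub => _ /asboolP[u eu <-]; apply: ez.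
  apply: (@kle_trans _ _ (reach q e^*%term * e^*)%term).
    apply: kle_dotl; exact: (reach_ub q e^*%term [::] (star_nil _)).
  apply: kle_starr; apply: sum_dot_lub => _ /asboolP[u eu <-].
  apply: IHe => v ev; rewrite -foldl_cat; apply: reach_ub.
  elim: eu => [|u1 u2 eu1 _ IH]; last by rewrite -catA; apply: star_cons.
  exact: lang_star1.
Qed.

(** Start from the empty path at [q], extend it along [e] to accepting states, insert [1 <= y q']
    there, and let leastness carry [y q'] back to [y q]. *)
Lemma automaton_le (F : pred Q) (y : Q -> term X) q e :
  (forall q x, H ⊢ Letter x * y (delta q x) ≦ y q) ->
  (forall q, F q -> H ⊢ 1 ≦ y q) ->
  (forall w, lang e w -> F (foldl delta q w)) ->
  H ⊢ e ≦ y q.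
Proof.
move=> ydelta yF eF; rewrite -(ka_dot1x H e).
apply: kle_trans (kle_dotl _ (paths_one (enum Q) q)) _.
apply: paths_reach => w /eF Fw.
rewrite -(ka_dotx1 H (S _ _)); apply: kle_trans (kle_dotr _ (yF _ Fw)) _.
exact: paths_least.
Qed.

Definition automaton_term (F : pred Q) (q : Q) : term X :=
  \big[@Plus X/Zero]_(q' | F q') S q q'.

End Automata.

Lemma lang_automaton_term (X Q : finType) (delta : Q -> X -> Q) (F : pred Q) q w :
  lang (automaton_term delta F q) w <-> F (foldl delta q w).
Proof.
split=> [/lang_sum[q' Fq' /lang_paths_sub->] //|Fw].
apply/lang_sum; exists (foldl delta q w) => // {Fw}.
elim/last_ind: w => [|w x IH]; first exact/(lang_sound (paths_one _ _ _ _)).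
rewrite foldl_rcons; set r := foldl _ _ _ in IH *.
apply: (lang_sound (e := (paths delta (enum Q) q r * paths delta (enum Q) r (delta r x))%term)).
  by apply: paths_dot; rewrite mem_enum.
exists w, [:: x]; split=> //; first by rewrite cats1.
exact: (lang_sound (paths_letter delta (@no_hypotheses X) (enum Q) r x)).
Qed.

(** * NetKAT *)

(** Membership and indices in lists of derivatives call for boolean equality on terms; it is
    obtained classically. *)
HB.instance Definition _ (X : Type) := gen_eqMixin (term X).

Section NetKATModels.
Variables (A : finType) (Q : Type) (D : A -> Q -> Q -> Prop).

(* A point is a state together with a packet, and [D] is the effect of [dup]
   on states. *)
Definition netkat_model (x : netkat_letter A) (s t : Q * A) : Prop :=
  match x with
  | inl (inl a) => s = t /\ s.2 = a
  | inl (inr b) => t = (s.1, b)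
  | inr _ => s.2 = t.2 /\ D s.2 s.1 t.1
  end.

(** Only [dup] touches the state, and it keeps the packet, so the equations hold for every [D]; this
    covers the output model and the finite ones at once. *)
Lemma netkat_satisfies : satisfies netkat_model (H_netkat A).
Proof.
suff eqP e f : netkat_equations e f ->
    forall s t, eval netkat_model e s t <-> eval netkat_model f s t.
  by move=> e f [] /eqP ef s t; rewrite ef.
case=> [a b|a|a|a||a b ab] [q c] [q' c'] /=.
- by split=> [[_ -> ->]|->] //; exists (q, a).
- by split=> [[_ -> [<- _]]|->] //; exists (q, a).
- by split=> [[_ [<- /= ->] ->]|[[<- <-] /= ->]] //; exists (q, a).
- split=> [[_ [<- /= ->]] [/= <- Dq]|[[r d] /= [<- Dq] [[<- <-] ca]]].
    by exists (q', a).
  by exists (q, c).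
- split=> [/eval_sum[a [->]] //|->].
  by apply/eval_sum; exists c'.
- by split=> // -[_ [<- /= ca] [_ /= cb]]; case: ab; rewrite -ca.
Qed.

End NetKATModels.

Section NetKAT.
Variable A : finType.
Notation L := (netkat_letter A).
Notation H := (H_netkat A).
Implicit Types (a b c : A) (e f g : term L) (v u : seq A).

(* The first component is the output still to be produced: [dup] emits the
   current packet. *)
Definition emits : L -> seq A * A -> seq A * A -> Prop :=
  netkat_model (fun a v v' => v = a :: v').

Lemma emits_sound e f s t : H ⊢ e ≦ f -> eval emits e s t -> eval emits f s t.
Proof. exact/ka_le_sound/netkat_satisfies. Qed.

Lemma netkat_eq e f : netkat_equations e f -> H ⊢ e ≡ f.
Proof. by move=> ef; apply: kle_anti; apply: ka_hyp; [left|right]. Qed.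

Lemma assign_assign a b : H ⊢ assign a * assign b ≡ assign b.
Proof. exact/netkat_eq/nk_assign_assign. Qed.

Lemma assign_atom a : H ⊢ assign a * atom a ≡ assign a.
Proof. exact/netkat_eq/nk_assign_atom. Qed.

Lemma atom_assign a : H ⊢ atom a * assign a ≡ atom a.
Proof. exact/netkat_eq/nk_atom_assign. Qed.

Lemma atom_dup a : H ⊢ atom a * dup A ≡ dup A * atom a.
Proof. exact/netkat_eq/nk_atom_dup. Qed.

Lemma atom_disjoint a b : a != b -> H ⊢ atom a * atom b ≡ 0.
Proof. by move/eqP=> ab; apply/netkat_eq/nk_atom_atom. Qed.

Lemma atom_idem a : H ⊢ atom a * atom a ≡ atom a.
Proof.
by rewrite -{1}atom_assign -ka_dotA assign_atom atom_assign.
Qed.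

(** Case analysis on the current packet, available because the atoms sum to 1. *)
Lemma by_atoms e g : (forall a, H ⊢ atom a * e ≦ g) -> H ⊢ e ≦ g.
Proof.
move=> ag; apply: kle_trans
  (@sum_dot_lub _ _ _ (index_enum A) xpredT (@atom A) e g (fun a _ => ag a)).
by apply: kle_eq; rewrite (netkat_eq (nk_sum_atoms A)) ka_dot1x.
Qed.

Lemma atom_le1 a : H ⊢ atom a ≦ 1.
Proof.
apply: kle_trans (kle_eq (netkat_eq (nk_sum_atoms A))).
exact: (@sum_ub _ _ _ _ (@atom A)).
Qed.

Lemma assign_disjoint a b e : a != b -> H ⊢ assign a * (atom b * e) ≡ 0.
Proof.
move=> ab; rewrite -(assign_atom a) !ka_dotA -(ka_dotA _ (assign a)).
by rewrite atom_disjoint // ka_dotx0 ka_dot0x.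
Qed.

(** [dup] keeps the packet, so setting it again has no effect: the first assignment provides the
    test [a], which commutes past [dup], absorbs the second assignment and commutes back. *)
Lemma assign_dup_assign a : H ⊢ assign a * dup A * assign a ≡ assign a * dup A.
Proof.
rewrite -{1}(assign_atom a) -!ka_dotA (ka_dotA _ (atom a)) atom_dup.
rewrite -!ka_dotA atom_assign -atom_dup ka_dotA.
by rewrite assign_atom.
Qed.

(* Antimirov's partial derivatives with respect to [dup] *)
Fixpoint pderivs e : seq (term L) :=
  match e with
  | Letter (inr _) => [:: One]
  | Plus e1 e2 => pderivs e1 ++ pderivs e2
  | Dot e1 e2 => [seq Dot g e2 | g <- pderivs e1] ++ pderivs e2
  | Star e1 => [seq Dot g (Star e1) | g <- pderivs e1]
  | _ => [::]
  end.

(** Makes the residual automaton finite: iterated derivatives of a term stay in its own list. *)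
Lemma pderivs_trans e g : g \in pderivs e -> {subset pderivs g <= pderivs e}.
Proof.
elim: e g => [||[[a|a]|u]|e IHe f IHf|e IHe f IHf|e IHe] g //=.
- by rewrite inE => /eqP->.
- rewrite mem_cat => /orP[/IHe|/IHf] sub h /sub; rewrite mem_cat => -> //.
  by rewrite orbT.
- rewrite mem_cat => /orP[/mapP[g' ge ->]|/IHf sub] h /=; last first.
    by move/sub => hf; rewrite mem_cat hf orbT.
  rewrite !mem_cat => /orP[/mapP[h' h'g ->]|->]; last by rewrite orbT.
  by rewrite map_f // (IHe g').
- move=> /mapP[g' ge ->] h /=; rewrite mem_cat.
  by case/orP=> [/mapP[h' h'g ->]|//]; rewrite map_f // (IHe g').
Qed.

(** A run of [g] is cut at its first [dup]. What precedes it only moves the packet, so inside a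
    derivation it shrinks to an assignment; what follows is a run of a partial derivative. *)
Lemma pderivs_complete g v c u b : eval emits g (v, c) (u, b) ->
  v = u /\ H ⊢ assign b ≦ assign c * g \/
  exists a v' g', [/\ v = a :: v', g' \in pderivs g,
    H ⊢ assign a * (dup A * g') ≦ assign c * g & eval emits g' (v', a) (u, b)].
Proof.
elim: g v c u b => [||[[a|a]|t]|e IHe f IHf|e IHe f IHf|e IHe] v c u b //=.
- by case=> -> ->; left; split=> //; apply: kle_eq; rewrite ka_dotx1.
- case=> -[-> ->] ->; left; split=> //.
  by apply: kle_eq; rewrite assign_atom.
- case=> -> ->; left; split=> //.
  by apply: kle_eq; rewrite assign_assign.
- move=> [-> ->]; right; exists b, u, 1%term; rewrite inE eqxx; split=> //.
  by apply: kle_eq; case: t; rewrite ka_dotx1.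
- case=> [/IHe|/IHf]; (case=> [[-> le]|[a [v' [g' [-> g'g le g't]]]]]; [left|right]).
  + by split=> //; apply: kle_trans le _; apply: kle_dotr; apply: kle_plusl.
  + exists a, v', g'; rewrite mem_cat g'g; split=> //.
    by apply: kle_trans le _; apply: kle_dotr; apply: kle_plusl.
  + by split=> //; apply: kle_trans le _; apply: kle_dotr; apply: kle_plusr.
  + exists a, v', g'; rewrite mem_cat g'g orbT; split=> //.
    by apply: kle_trans le _; apply: kle_dotr; apply: kle_plusr.
- case=> -[u1 c1] /IHe[[-> le1]|[a [v' [g' [-> g'g le g't]]]]] ft; last first.
    right; exists a, v', (g' * f)%term; rewrite mem_cat map_f //; split=> //.
      by rewrite !ka_dotA in le *; apply: kle_dotl.
    by exists (u1, c1).
  case: (IHf _ _ _ _ ft) => [[-> le2]|[a [v' [g' [-> g'g le2 g't]]]]]; [left|right].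
    by split=> //; apply: kle_assoc; apply: kle_trans le2 _; apply: kle_dotl.
  exists a, v', g'; rewrite mem_cat g'g orbT; split=> //.
  by apply: kle_assoc; apply: kle_trans le2 _; apply: kle_dotl.
- move Es: (v, c) => s; move Et: (u, b) => t st.
  elim: st v c Es Et => [{}s v c <- [-> ->]|{}s [v1 c1] {}t st1 st2 IH v c Es Et].
    by left; split=> //; apply/kle_mulr/kle_star1.
  move: st1 st2; rewrite -Es -Et.
  move=> /IHe[[-> le1]|[a [v' [g' [-> g'g le g't]]]]] ft; last first.
    right; exists a, v', (g' * e^*)%term; rewrite map_f //; split=> //.
      apply: kle_trans (kle_dotr _ (kle_star_unfold _ e)).
      by rewrite !ka_dotA in le *; apply: kle_dotl.
    by exists (v1, c1).
  (* An iteration that emits nothing moves the packet from [c] to [c1] and is folded back into the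
     star; the first emitting iteration lies further along the run. *)
  have step h : H ⊢ h ≦ assign c1 * e^* -> H ⊢ h ≦ assign c * e^*.
    move=> hle; apply: kle_trans hle _.
    apply: kle_trans (kle_dotr _ (kle_star_unfold _ e)).
    by apply: kle_assoc; apply: kle_dotl.
  case: (IH _ _ erefl Et) => [[-> /step le2]|[a [v' [g' [-> g'g /step le2 g't]]]]].
    by left.
  by right; exists a, v', g'; rewrite Et.
Qed.

(** * The residual automaton and the automaton on words built from it *)

Section Residuals.
Variable l : seq (term L).
Hypothesis l_closed : forall g, g \in l -> {subset pderivs g <= l}.

(** A pair [(a, i)] stands for the assignment of [a] followed by the [i]-th term of [l]; indices
    instead of terms make the states a finite type. *)
Definition residual : finType := {set A * 'I_(size l)}.
Implicit Types Z : residual.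

Definition residual_term Z : term L :=
  \big[@Plus L/Zero]_(i in Z) Dot (assign i.1) (nth Zero l i.2).

(** Transitions are defined by derivability rather than by syntax: each step is sound by
    construction, and [pderivs_complete] supplies enough of them. *)
Definition residual_step Z b : residual :=
  [set i : A * 'I_(size l) | (i.1 == b) &&
    `[< H ⊢ assign b * (dup A * nth Zero l i.2) ≦ residual_term Z >]].

Definition residual_final Z b : bool := `[< H ⊢ assign b ≦ residual_term Z >].

Definition residual_accepts Z v b := residual_final (foldl residual_step Z v) b.

Lemma residual_assign Z b : H ⊢ assign b * residual_term Z ≦ residual_term Z.
Proof.
apply: dot_sum_lub => i iZ; rewrite ka_dotA assign_assign.
exact: (@sum_ub _ _ _ (mem Z) (fun i => Dot (assign i.1) (nth Zero l i.2))).
Qed.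

Lemma residual_dup Z b :
  H ⊢ assign b * (dup A * residual_term (residual_step Z b)) ≦ residual_term Z.
Proof.
rewrite ka_dotA; apply: dot_sum_lub => i; rewrite inE => /andP[/eqP-> /asboolP le].
by rewrite ka_dotA assign_dup_assign -ka_dotA.
Qed.

(** Soundness reads each transition as a derivable inequation in the output model. Completeness
    follows a run from one [dup] to the next; closedness of [l] keeps the derivatives among the
    states. *)
Lemma residual_acceptsP Z v b : residual_accepts Z v b <->
  exists2 i, i \in Z & eval emits (nth Zero l i.2) (v, i.1) ([::], b).
Proof.
split.
  (* Every summand of a residual begins with an assignment, which overwrites the incoming packet
     [c]. *)
  have soundZ v' c : eval emits (residual_term Z) (v', c) ([::], b) ->
      exists2 i, i \in Z & eval emits (nth Zero l i.2) (v', i.1) ([::], b).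
    case/evalP=> w /lang_sum[i iZ Zw] wr; exists i => //.
    have /= [_ -> //] : eval emits (assign i.1 * nth Zero l i.2)%term (v', c) ([::], b).
    by apply/evalP; exists w.
  suff: residual_accepts Z v b -> eval emits (residual_term Z) (v, b) ([::], b).
    by move=> h /h/soundZ.
  clear soundZ; rewrite /residual_accepts; move: {2}b => c.
  elim: v c Z => [|a v IH] c Z /=.
    by move/asboolP/emits_sound; apply.
  move/(IH a) => ev; apply: (emits_sound (residual_dup Z a)) => /=.
  by exists (a :: v, a) => //; exists (v, a).
elim: v Z => [|a v IH] Z [i iZ /pderivs_complete[]] //.
- case=> _ le; apply/asboolP; apply: kle_trans le _.
  exact: (@sum_ub _ _ _ (mem Z) (fun i => Dot (assign i.1) (nth Zero l i.2))).
- by case=> a [v' [g' []]].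
- by case.
- case=> _ [_ [g' [[<- <-] g'l le ev]]].
  have {}g'l : g' \in l by apply: l_closed g'l; apply: mem_nth.
  have lt : index g' l < size l by rewrite index_mem.
  apply: IH; exists (a, Ordinal lt); rewrite /= ?nth_index // inE eqxx /=.
  rewrite nth_index //; apply/asboolP; apply: kle_trans le _.
  exact: (@sum_ub _ _ _ (mem Z) (fun i => Dot (assign i.1) (nth Zero l i.2))).
Qed.

(** The packet is tracked and fed to the residual at each [dup]. [None] records a failed test: the
    word has no run from the initial packet, so every continuation is accepted. *)
Definition word_step (q : option (A * residual)) (x : L) : option (A * residual) :=
  if q is Some (b, Z) then
    match x with
    | inl (inl a) => if a == b then q else None
    | inl (inr c) => Some (c, Z)
    | inr _ => Some (b, residual_step Z b)
    end
  else None.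

Definition word_final (q : option (A * residual)) : bool :=
  if q is Some (b, Z) then residual_final Z b else true.

Lemma word_finalP b Z w : word_final (foldl word_step (Some (b, Z)) w) <->
  (forall v c, run emits w (v, b) ([::], c) -> residual_accepts Z v c).
Proof.
have dead (u : seq L) : foldl word_step None u = None by elim: u.
elim: w b Z => [|[[a|a]|[]] w IH] b Z /=.
- by split=> [fin v c [-> <-] //|fin]; apply: (fin [::]).
- case: eqP => [->|ab]; last first.
    by rewrite dead; split=> // _ v c [u [_ /= ba]]; case: ab.
  rewrite IH; split=> h v c; last by move=> r; apply: h; exists (v, b).
  by case=> _ [<- _]; apply: h.
- rewrite IH; split=> h v c; last by move=> r; apply: h; exists (v, a).
  by case=> _ ->; apply: h.
- rewrite IH; split=> h v c.
    by case=> -[v' _] [/= <- ->]; apply: h.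
  by move=> r; apply: (h (b :: v)); exists (v, b).
Qed.

(** A state [(b, Z)] constrains behaviour on packet [b] only and allows everything on the others, so
    its inequations can be checked atom by atom. *)
Definition word_term (q : option (A * residual)) : term L :=
  if q is Some (b, Z) then
    Plus (Dot (atom b) (residual_term Z))
      (\big[@Plus L/Zero]_(a | a != b) Dot (atom a) (top_term L))
  else top_term L.

Lemma atom_word_term b Z :
  H ⊢ atom b * word_term (Some (b, Z)) ≦ atom b * residual_term Z.
Proof.
rewrite ka_dotDr; apply: kle_lub; first by apply: kle_eq; rewrite ka_dotA atom_idem.
apply: dot_sum_lub => a ab.
by rewrite ka_dotA atom_disjoint 1?eq_sym // ka_dot0x; apply: kle_0.
Qed.

Lemma word_term_step q x : H ⊢ Letter x * word_term (word_step q x) ≦ word_term q.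
Proof.
case: q => [[b Z]|]; last exact: kle_top.
have other a e : a != b -> H ⊢ atom a * e ≦ word_term (Some (b, Z)).
  move=> ab; apply: kle_trans (kle_plusr _ _ _).
  apply: kle_trans (kle_dotr _ (kle_top _ e)) _.
  exact: (@sum_ub _ _ _ (fun a => a != b) (fun a => Dot (atom a) (top_term L))).
have this e : H ⊢ e ≦ residual_term Z -> H ⊢ atom b * e ≦ word_term (Some (b, Z)).
  by move=> le; apply: kle_trans (kle_plusl _ _ _); apply: kle_dotr.
case: x => [[a|c]|[]].
- rewrite /=; have [->|ab] := eqVneq a b; last exact: other.
  rewrite ka_dotDr; apply: kle_lub.
    by rewrite ka_dotA atom_idem; apply: this; apply: kle_refl.
  apply: dot_sum_lub => a' a'b.
  by rewrite ka_dotA atom_disjoint 1?eq_sym // ka_dot0x; apply: kle_0.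
(* After the assignment of [c], the test for [c] is absorbed and the summands for other packets
   vanish. *)
- apply: (@kle_trans _ _ (assign c * residual_term Z)%term).
    rewrite ka_dotDr; apply: kle_lub.
      by rewrite ka_dotA assign_atom; apply: kle_refl.
    apply: dot_sum_lub => a' a'b.
    by rewrite assign_disjoint 1?eq_sym //; apply: kle_0.
  apply: by_atoms => a; have [->|/other //] := eqVneq a b.
  exact/this/residual_assign.
- apply: by_atoms => a; have [->|/other //] := eqVneq a b.
  (* The test [b] passes [dup] to cut the word term down to its residual, then returns and yields
     the assignment that [residual_dup] expects. *)
  apply: (@kle_trans _ _ (atom b * (assign b * (dup A * residual_term (residual_step Z b))))%term).
    rewrite ka_dotA atom_dup -ka_dotA; apply: kle_trans (kle_dotr _ (atom_word_term _ _)) _.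
    by apply: kle_eq; rewrite ka_dotA -atom_dup ka_dotA atom_assign -ka_dotA.
  exact/this/residual_dup.
Qed.

Lemma word_term_final q : word_final q -> H ⊢ 1 ≦ word_term q.
Proof.
case: q => [[b Z] /asboolP fin|_]; last exact: kle_top.
apply: by_atoms => a; have [->|ab] := eqVneq a b; rewrite ka_dotx1.
  apply: kle_trans (kle_plusl _ _ _); rewrite -{1}atom_assign.
  exact: kle_dotr.
apply: kle_trans (kle_plusr _ _ _).
apply: kle_trans (@sum_ub _ _ _ (fun a => a != b) (fun a => Dot (atom a) (top_term L)) a ab).
exact/kle_mulr/kle_top.
Qed.

Lemma word_term_complete b Z e :
  (forall v c, eval emits e (v, b) ([::], c) -> residual_accepts Z v c) ->
  H ⊢ e ≦ word_term (Some (b, Z)).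
Proof.
move=> eZ; apply: (automaton_le word_term_step word_term_final) => w ew.
by apply/word_finalP => v c wr; apply: eZ; apply/evalP; exists w.
Qed.

End Residuals.

Definition residual_terms f := f :: pderivs f.

Lemma residual_terms_closed f g :
  g \in residual_terms f -> {subset pderivs g <= residual_terms f}.
Proof.
rewrite inE => /orP[/eqP-> h hf|/pderivs_trans sub h /sub hf]; by rewrite inE hf orbT.
Qed.

(** Index 0 is [f] itself, the head of [residual_terms f]. *)
Definition start f a : residual (residual_terms f) := [set (a, ord0)].

Lemma start_accepts f a v b :
  residual_accepts (start f a) v b <-> eval emits f (v, a) ([::], b).
Proof.
split=> [/(residual_acceptsP (@residual_terms_closed f))[i]|ev].
  by rewrite in_set1 => /eqP->.
apply/(residual_acceptsP (@residual_terms_closed f)).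
by exists (a, ord0) => //; rewrite in_set1.
Qed.

Lemma emits_complete e f :
  (forall a v b, eval emits e (v, a) ([::], b) -> eval emits f (v, a) ([::], b)) ->
  H ⊢ e ≦ f.
Proof.
(* For packet [a] the automaton starts at [start f a]. The test [a] removes the top part of its word
   term and then absorbs the assignment guarding [f]. *)
move=> ef; apply: by_atoms => a.
have /kle_dotr le : H ⊢ e ≦ word_term (Some (a, start f a)).
  by apply: word_term_complete => v c /ef/start_accepts.
apply: kle_trans (le (atom a)) _; apply: kle_trans (atom_word_term _ _) _.
apply: dot_sum_lub => i; rewrite inE => /eqP->.
rewrite ka_dotA atom_assign; apply: kle_trans (kle_dotl _ (atom_le1 a)) _.
by apply: kle_eq; rewrite ka_dot1x.
Qed.

(** A closure step exchanges a segment of a word along a hypothesis; the output model satisfies it,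
    so the run keeps its endpoints. *)
Lemma closure_emits (K : language L) w s t :
  Defs.closure H K w -> run emits w s t -> exists2 u, K u & run emits u s t.
Proof.
move=> Kw; elim: Kw s t => {w} [w Kw|e f u v ef _ IH w ew] s t; first by exists w.
case/run_cat=> s1 us1 /run_cat[s2 s12 s2t].
have [w' fw' w's12] : exists2 w', lang f w' & run emits w' s1 s2.
  apply/evalP/(@netkat_satisfies _ _ _ e f ef); apply/evalP; by exists w.
apply: (IH w' fw'); apply/run_cat; exists s1 => //.
by apply/run_cat; exists s2.
Qed.

Lemma netkat_complete : ka_complete H.
Proof.
suff le e f : (forall w, Defs.closure H (lang e) w -> Defs.closure H (lang f) w) -> H ⊢ e ≦ f.
  by move=> e f ef; apply: kle_anti; apply: le => w /ef.
move=> ef; apply: emits_complete => a v b /evalP[w ew wr].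
apply/evalP; apply: closure_emits wr; apply: ef.
exact: closure_incl.
Qed.

(* A word lies in the language of [closed_term e] iff all its runs are runs of
   [e]; the automaton follows one residual of [e] for each initial packet. *)
Definition closed_step e (q : {ffun A -> option (A * residual (residual_terms e))})
    (x : L) := [ffun a => word_step (q a) x].

Definition closed_term e : term L :=
  automaton_term (@closed_step e) (fun q => [forall a, word_final (q a)])
    [ffun a => Some (a, start e a)].

Lemma lang_closed_term e w : lang (closed_term e) w <->
  (forall a v b, run emits w (v, a) ([::], b) -> eval emits e (v, a) ([::], b)).
Proof.
have stepE q a : foldl (@closed_step e) q w a = foldl (@word_step _) (q a) w.
  by elim: w q => //= x w IH q; rewrite IH ffunE.
split=> [/lang_automaton_term/forallP fin a v b wr|ev].
  apply/start_accepts; move: (fin a); rewrite stepE ffunE.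
  by move/word_finalP; apply.
apply/lang_automaton_term/forallP => a; rewrite stepE ffunE.
by apply/word_finalP => v c wr; apply/start_accepts/ev.
Qed.

Lemma closed_term_eq e : H ⊢ e ≡ closed_term e.
Proof.
apply: kle_anti; apply: emits_complete => a v b /evalP[w].
  move=> ew wr; apply/evalP; exists w => //; apply/lang_closed_term => a' v' b' wr'.
  by apply/evalP; exists w.
by move/lang_closed_term; apply.
Qed.

Lemma netkat_reduces : reduces_to_empty H.
Proof.
pose sub (x : L) : {x : L | predT x} := exist _ x isT.
exists predT; split=> //; exists (fun e => map_term sub (closed_term e)).
split=> e => [|w ew].
  by rewrite map_term_comp map_term_id //; apply: closed_term_eq.
(* A word in the closure of [e] has only runs of [e], hence it already lies in the language of
   [closed_term e]. *)
apply: closure_incl; have -> : w = map sub (map sval w).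
  by rewrite -map_comp -[LHS]map_id; apply: eq_map => x; apply: val_inj.
apply/lang_map/lang_closed_term => a v b /(closure_emits ew)[u eu ur].
by apply/evalP; exists u.
Qed.

End NetKAT.

(** * Finite models *)

(** A path without repeated states in the transition graph has fewer than [#|T|] edges; choosing a
    letter for each edge gives the word. *)
Lemma short_word (X T : finType) (delta : T -> X -> T) (P : pred T) q w :
  P (foldl delta q w) -> exists2 w', size w' < #|T| & P (foldl delta q w').
Proof.
pose e t t' := [exists x, delta t x == t'].
have : connect e q (foldl delta q w).
  elim: w q => [|x w IH] q //=; apply: connect_trans (IH _).
  by apply: connect1; apply/existsP; exists x.
case/connectP => p0; case/shortenP => p ep up _ -> Pp.
have [w' sw' ew'] : exists2 w', size w' = size p & foldl delta q w' = last q p.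
  elim: p q {up Pp} ep => [|t p IH] q /=; first by exists [::].
  by case/andP => /existsP[x /eqP<-] /IH[w' <- <-]; exists (x :: w').
exists w'; rewrite ?ew' // sw'.
by have := max_card (mem (q :: p)); rewrite (card_uniqP up).
Qed.

Lemma leq_pair_code x y : x + y <= pair_code x y.
Proof. by rewrite /pair_code binS bin1 -addnA addnCA leq_addr. Qed.

Lemma leq_pair_codel x y : x <= pair_code x y.
Proof. exact: leq_trans (leq_addr _ _) (leq_pair_code x y). Qed.

Lemma leq_pair_coder x y : y <= pair_code x y.
Proof. exact: leq_trans (leq_addl _ _) (leq_pair_code x y). Qed.

Lemma ltn_pair_coder x y : 0 < x -> y < pair_code x y.
Proof. by move=> x0; apply: leq_trans (leq_pair_code x y); rewrite -addn1 addnC leq_add2r. Qed.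

Lemma card_set_type (T : finType) : #|{set T}| = 2 ^ #|T|.
Proof.
rewrite -(cardsT T) -card_powerset; apply: eq_card => B.
by rewrite !inE subsetT.
Qed.

(** * A computable bound on distinguishing outputs *)

Section WordBound.
Variable A : finType.
Notation H := (H_netkat A).

Lemma size_pderivs e : size (@pderivs A e) <= term_code e.
Proof.
elim: e => [||[[a|a]|u]|e IHe f IHf|e IHe f IHf|e IHe] //=.
- exact: leq_trans (leq_pair_codel _ _).
- rewrite size_cat; apply: leq_trans (leq_add IHe IHf) _.
  exact: leq_trans (leq_pair_code _ _) (leq_pair_coder _ _).
- rewrite size_cat size_map; apply: leq_trans (leq_add IHe IHf) _.
  exact: leq_trans (leq_pair_code _ _) (leq_pair_coder _ _).
- by rewrite size_map; apply: leq_trans IHe (leq_pair_coder _ _).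
Qed.

(** Bounds the number of pairs of residuals: for code [x], a residual is a set of pairs of a packet
    and one of at most [x.+1] terms, and likewise for [y]. *)
Definition word_bound x y := 2 ^ (#|A| * (x.+1 + y.+1)).

(** In the product of the two residual automata, disagreement on the final packet [b] depends only
    on the state reached, so [short_word] moves it to a short output. *)
Lemma emits_bounded e f :
  (forall a v b, size v < word_bound (term_code e) (term_code f) ->
     eval (@emits A) e (v, a) ([::], b) <-> eval (@emits A) f (v, a) ([::], b)) ->
  H ⊢ e ≡ f.
Proof.
move=> ef; pose T : finType :=
  (residual (residual_terms e) * residual (residual_terms f))%type.
pose delta (q : T) a : T := (residual_step q.1 a, residual_step q.2 a).
have deltaE q v : foldl delta q v =
    (foldl (@residual_step _ _) q.1 v, foldl (@residual_step _ _) q.2 v).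
  by elim: v q => [|a v IH] [q1 q2] //=; rewrite IH.
have cardT : #|T| <= word_bound (term_code e) (term_code f).
  rewrite card_prod !card_set_type !card_prod !card_ord -expnD leq_exp2l //.
  by rewrite -mulnDr leq_mul2l leq_add ?orbT //= ltnS size_pderivs.
suff agree a v b : eval (@emits A) e (v, a) ([::], b) <-> eval (@emits A) f (v, a) ([::], b).
  by apply: kle_anti; apply: emits_complete => a v b /agree.
suff: residual_accepts (start e a) v b = residual_accepts (start f a) v b.
  by rewrite -!start_accepts => ->.
apply/eqP; apply: contraT => neq.
pose P (q : T) := residual_final q.1 b != residual_final q.2 b.
have : P (foldl delta (start e a, start f a) v) by rewrite deltaE.
case/short_word => u su; rewrite /P deltaE /= => /negP[].
apply/eqP; apply/idP/idP => /start_accepts/ef acc; apply/start_accepts/acc;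
  exact: leq_trans su cardT.
Qed.

End WordBound.

(** * Positional coding of finite sequences and sets *)

Definition digit V h i := (h %/ V ^ i) %% V.

Definition collect V N (F : nat -> nat) := \sum_(i < N) F i * V ^ i.

Lemma collect_lt V N F : (forall i, i < N -> F i < V) -> collect V N F < V ^ N.
Proof.
rewrite /collect; elim: N => [|N IH] FV; first by rewrite big_ord0.
rewrite big_ord_recr /= expnS.
have FN : F N <= V.-1 by rewrite -ltnS (ltn_predK (FV N _)) // FV.
apply: (@leq_trans (V ^ N + V.-1 * V ^ N)).
  rewrite -addSn leq_add ?leq_mul2r ?FN ?orbT //.
  by apply: IH => i iN; apply: FV; apply: ltnW.
by rewrite -mulSn (ltn_predK (FV N _)).
Qed.

Lemma digit_collect V N F i : (forall i, i < N -> F i < V) -> i < N ->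
  digit V (collect V N F) i = F i.
Proof.
move=> FV iN; have V0 : 0 < V by apply: leq_ltn_trans (FV i iN).
rewrite /digit; elim: N iN FV => // N IH; rewrite ltnS leq_eqVlt /collect.
case/orP => [/eqP-> FV|iN FV]; rewrite big_ord_recr /= addnC.
  rewrite divnMDl ?expn_gt0 ?V0 // divn_small ?addn0 ?modn_small ?FV //.
  by apply: collect_lt => j jN; apply/FV/ltnW.
(* As [i < N], dividing the leading term by [V ^ i] leaves a multiple of [V], which does not change
   digit [i]. *)
have -> : F N * V ^ N = F N * V ^ (N - i.+1) * V * V ^ i.
  by rewrite -!mulnA -expnS -expnD subnK.
rewrite divnMDl ?expn_gt0 ?V0 // modnMDl; apply: IH => // j jN.
exact/FV/ltnW.
Qed.

Definition bit c i : bool := digit 2 c i == 1.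

Definition bitmask N (P : nat -> bool) := collect 2 N P.

Lemma bit_bitmask N P i : i < N -> bit (bitmask N P) i = P i.
Proof.
by move=> iN; rewrite /bit digit_collect // => [|j _]; [case: (P i) | case: (P j)].
Qed.

Lemma bitmask_lt N P : bitmask N P < 2 ^ N.
Proof. by apply: collect_lt => i _; case: (P i). Qed.

Lemma eq_bitmask N P P' : (forall i, i < N -> P i = P' i) -> bitmask N P = bitmask N P'.
Proof. by move=> PP; apply: eq_bigr => i _; rewrite PP. Qed.

Lemma index3_inj m x y z x' y' z' : y < m -> z < m -> y' < m -> z' < m ->
  (x * m + y) * m + z = (x' * m + y') * m + z' -> [/\ x = x', y = y' & z = z'].
Proof.
have inj2 a b a' b' : b < m -> b' < m -> a * m + b = a' * m + b' -> a = a' /\ b = b'.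
  move=> bm b'm ab; have m0 : 0 < m by apply: leq_ltn_trans bm.
  move: (congr1 (divn^~ m) ab) (congr1 (modn^~ m) ab).
  by rewrite !divnMDl // !modnMDl !modn_small // !divn_small // !addn0.
by move=> ym zm y'm z'm /inj2[] // /inj2[].
Qed.

(** * Finite models coded by numbers *)

Section FiniteModels.
Variable A : finType.
Notation H := (H_netkat A).
Notation k := #|A|.

(* The number [c] codes the effect of [dup] on the states below [m]. *)
Definition coded_dup m c (a : A) q q' : Prop :=
  [&& q < m, q' < m & bit c ((enum_rank a * m + q) * m + q')].

Definition coded_model m c := netkat_model (coded_dup m c).

(* A word [v] is coded by the model that reads it letter by letter, with the
   suffix [drop q v] for state [q]. *)
Lemma coded_models_complete e f m : word_bound A (term_code e) (term_code f) <= m ->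
  (forall c, c < 2 ^ (k * m * m) -> forall s t, s.1 < m ->
    eval (coded_model m c) e s t <-> eval (coded_model m c) f s t) ->
  H ⊢ e ≡ f.
Proof.
move=> bm ef; apply: emits_bounded => a v b /leq_trans/(_ bm) vm.
(* The bit for [j] lets [dup] move from state [j] to [j.+1] at the [j]-th packet of [v]. The last
   state is [size v], which is below [m]. *)
pose P i := [exists j : 'I_(size v),
  i == (enum_rank (nth a v j) * m + j) * m + j.+1].
pose c := bitmask (k * m * m) P.
have dupE a' q q' : coded_dup m c a' q q' <->
    [/\ q < size v, nth a v q = a' & q' = q.+1].
  split=> [/and3P[qm q'm]|[qv <- ->]].
    rewrite bit_bitmask; last first.
      apply: (@leq_trans ((enum_rank a' * m + q).+1 * m)).
        by rewrite mulSn addnC ltn_add2r.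
      rewrite leq_mul2r; apply/orP; right.
      apply: (@leq_trans ((enum_rank a').+1 * m)); first by rewrite mulSn addnC ltn_add2r.
      by rewrite leq_mul2r ltn_ord orbT.
    case/existsP=> j /eqP/index3_inj[] //.
    - exact: ltn_trans vm.
    - exact: leq_ltn_trans vm.
    by move=> /ord_inj/enum_rank_inj-> -> ->; split.
  have qm : q.+1 < m by apply: leq_ltn_trans vm.
  rewrite /coded_dup (ltnW qm) qm bit_bitmask.
    by apply/existsP; exists (Ordinal qv).
  apply: (@leq_trans ((enum_rank (nth a v q) * m + q).+1 * m)).
    by rewrite mulSn addnC ltn_add2r.
  rewrite leq_mul2r; apply/orP; right.
  apply: (@leq_trans ((enum_rank (nth a v q)).+1 * m)).
    by rewrite mulSn addnC ltn_add2r ltnW.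
  by rewrite leq_mul2r ltn_ord orbT.
pose h (s : nat * A) := (drop s.1 v, s.2).
have bisim x s t' : emits x (h s) t' <-> exists2 t, coded_model m c x s t & t' = h t.
  case: x s t' => [[a'|a']|[]] [q d] [u d'] /=.
  - by split=> [[[<- <-] ->]|[_ [<- ->] ->]] //; exists (q, a').
  - by split=> [[-> ->]|[_ -> ->]] //; exists (q, a').
  - split=> [[<- qu]|[[q' d2] /= [<- /dupE[qv qd ->]] [-> ->]]]; last first.
      by split=> //; rewrite (drop_nth a) // qd.
    have qv : q < size v.
      by rewrite ltnNge; apply/negP => /drop_oversize qv; rewrite qv in qu.
    move: qu; rewrite (drop_nth a) // => -[qd qu]; exists (q.+1, d).
      by split=> //=; apply/dupE.
    by rewrite /h /= qu.
have ha : (v, a) = h (0, a) by rewrite /h drop0.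
have m0 : 0 < m by apply: leq_ltn_trans vm.
have c_lt : c < 2 ^ (k * m * m) by apply: bitmask_lt.
rewrite ha; split=> /(eval_bisim bisim)[t et ->]; apply/(eval_bisim bisim);
  by exists t => //; apply/(ef c).
Qed.

Lemma coded_models_sound e f m c s t : H ⊢ e ≡ f ->
  eval (coded_model m c) e s t <-> eval (coded_model m c) f s t.
Proof. by move=> ef; exact: (ka_eq_sound (@netkat_satisfies A nat (coded_dup m c)) ef). Qed.

(* [coded_model] with the point [(q, a)] renumbered as [q * k + enum_rank a] *)
Definition table_model m c (x : netkat_letter A) s t : bool :=
  match x with
  | inl (inl a) => (s == t) && (s %% k == enum_rank a)
  | inl (inr b) => (s %/ k == t %/ k) && (t %% k == enum_rank b)
  | inr _ => (s %% k == t %% k) &&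
      [&& s %/ k < m, t %/ k < m & bit c ((s %% k * m + s %/ k) * m + t %/ k)]
  end.

Definition renumber (s : nat * A) := s.1 * k + enum_rank s.2.

Lemma renumberP m s : s < m * k -> exists2 p, p.1 < m & s = renumber p.
Proof.
move=> sm; have k0 : 0 < k by case: k sm => //; rewrite muln0.
have lt : s %% k < k by rewrite ltn_mod.
exists (s %/ k, enum_val (Ordinal lt)); first by rewrite /= ltn_divLR.
by rewrite /renumber enum_valK -divn_eq.
Qed.

Lemma renumber_lt m p : p.1 < m -> renumber p < m * k.
Proof.
move=> pm; apply: (@leq_trans (p.1.+1 * k)); last by rewrite leq_mul2r pm orbT.
by rewrite /renumber mulSn addnC ltn_add2r.
Qed.

Lemma renumber_div p : renumber p %/ k = p.1.
Proof.
have k0 : 0 < k by apply: leq_ltn_trans (ltn_ord (enum_rank p.2)).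
by rewrite divnMDl // divn_small ?addn0.
Qed.

Lemma renumber_mod p : renumber p %% k = enum_rank p.2.
Proof. by rewrite modnMDl modn_small. Qed.

Lemma renumber_inj : injective renumber.
Proof.
move=> [q a] [q' a'] E; have := renumber_mod (q, a); have := renumber_div (q, a).
by rewrite E renumber_div renumber_mod /= => -> /ord_inj/enum_rank_inj->.
Qed.

Lemma table_model_bisim m c x s t' : table_model m c x (renumber s) t' <->
  exists2 t, coded_model m c x s t & t' = renumber t.
Proof.
case: s => q d; rewrite /table_model; case: x => [[a|a]|u].
- rewrite renumber_mod; split=> [/andP[/eqP<- /eqP/ord_inj/enum_rank_inj/= da]|].
    by exists (q, d).
  by case=> _ [<- /= ->] ->; rewrite !eqxx.
- rewrite renumber_div; split=> [/andP[/eqP/= qt /eqP ta]|].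
    by exists (q, a) => //; rewrite /renumber /= qt -ta -divn_eq.
  by case=> _ /= -> ->; rewrite renumber_div renumber_mod !eqxx.
- rewrite renumber_div renumber_mod /=; split=> [/andP[/eqP dt D]|].
    by exists (t' %/ k, d) => //; rewrite /renumber /= dt -divn_eq.
  by case=> -[q' d'] /= [<- D] ->; rewrite renumber_mod renumber_div eqxx.
Qed.

Lemma eval_renumber m c e s t : 
  eval (table_model m c) e (renumber s) (renumber t) <-> eval (coded_model m c) e s t.
Proof.
rewrite (eval_bisim (@table_model_bisim m c)).
by split=> [[u su /renumber_inj->]|]; last by exists t.
Qed.

(** Tables record only points below [m * k], so products and iterations must not leave that range.
    In the coded model only [dup] changes the state, and it bounds its target. *)
Lemma table_model_lt m c e s t :
  eval (table_model m c) e s t -> s < m * k -> t < m * k.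
Proof.
move=> st /renumberP[p pm Es]; move: st; rewrite {}Es.
case/(eval_bisim (@table_model_bisim m c)) => t' pt ->.
apply: renumber_lt.
elim: e p t' pt pm => [||[[a|a]|u]|e IHe f IHf|e IHe f IHf|e IHe] p t' //=.
- by move=> <-.
- by case=> <-.
- by move=> ->.
- by case=> _ /and3P[].
- by case=> [/IHe|/IHf].
- by case=> u /IHe pu /IHf ut /pu.
- by elim=> // s1 s2 s3 /IHe s12 _ IH /s12.
Qed.

End FiniteModels.

(** * Recursive functions *)

(* Functions of a list of arguments: binders then extend the list at its head,
   and [drop] gives back the arguments of the context. *)
Definition Rec n (F : seq nat -> nat) := recursive (fun v : n.-tuple nat => F v).

Lemma Rec_ext n F G : Rec n F -> (forall v, size v = n -> F v = G v) -> Rec n G.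
Proof.
move=> RF FG; rewrite /Rec.
have -> // : (fun v : n.-tuple nat => G v) = (fun v : n.-tuple nat => F v).
by apply: funext => v; rewrite FG // size_tuple.
Qed.

Lemma Rec_comp m n G (h : seq (seq nat -> nat)) : Rec m G -> size h = m ->
  (forall i, Rec n (nth (fun=> 0) h i)) -> Rec n (fun v => G [seq f v | f <- h]).
Proof.
move=> RG sh Rh; pose h' (i : 'I_m) (v : n.-tuple nat) := nth (fun=> 0) h i v.
apply: (rec_comp RG (h := h')) => [i|v]; first exact: Rh.
congr G; apply: (@eq_from_nth _ 0); rewrite size_map ?size_tuple // => i.
rewrite sh => im; rewrite (nth_map (fun=> 0)) ?sh //.
by rewrite -(tnth_nth 0 _ (Ordinal im)) tnth_mktuple.
Qed.

Lemma Rec_const n c : Rec n (fun=> c).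
Proof.
elim: c => [|c IH]; first exact: rec_zero.
apply: (rec_comp rec_succ (h := fun _ _ => c)) => [i|v]; first exact: IH.
by rewrite tnth_mktuple.
Qed.

Lemma Rec_nth n i : Rec n (fun v => nth 0 v i).
Proof.
have [im|ni] := ltnP i n; last first.
  by apply: Rec_ext (Rec_const n 0) _ => v sv; rewrite nth_default ?sv.
rewrite /Rec; have -> : (fun v : n.-tuple nat => nth 0 v i) =
    (fun v : n.-tuple nat => tnth v (Ordinal im)).
  by apply: funext => v; rewrite (tnth_nth 0).
exact: rec_proj.
Qed.

Definition is_drop (D : seq nat -> seq nat) := exists k, forall v, D v = drop k v.

Lemma is_drop_id : is_drop id.
Proof. by exists 0 => v; rewrite drop0. Qed.

Lemma is_drop_drop k D : is_drop D -> is_drop (fun v => drop k (D v)).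
Proof. by case=> k' Dk; exists (k + k') => v; rewrite Dk drop_drop. Qed.

Lemma Rec_var n D i : is_drop D -> Rec n (fun v => nth 0 (D v) i).
Proof.
case=> k Dk; apply: Rec_ext (Rec_nth n (k + i)) _ => v _.
by rewrite Dk nth_drop.
Qed.

Definition Rec1 g := Rec 1 (fun v => g (nth 0 v 0)).
Definition Rec2 g := Rec 2 (fun v => g (nth 0 v 0) (nth 0 v 1)).
Definition Rec3 g := Rec 3 (fun v => g (nth 0 v 0) (nth 0 v 1) (nth 0 v 2)).
Definition Rec4 g :=
  Rec 4 (fun v => g (nth 0 v 0) (nth 0 v 1) (nth 0 v 2) (nth 0 v 3)).

Lemma Rec_app1 g n F : Rec1 g -> Rec n F -> Rec n (fun v => g (F v)).
Proof.
move=> Rg RF; apply: (Rec_comp (h := [:: F]) Rg) => // -[|i] //=.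
by rewrite nth_nil; apply: Rec_const.
Qed.

Lemma Rec_app2 g n F1 F2 : Rec2 g -> Rec n F1 -> Rec n F2 ->
  Rec n (fun v => g (F1 v) (F2 v)).
Proof.
move=> Rg R1 R2; apply: (Rec_comp (h := [:: F1; F2]) Rg) => // -[|[|i]] //=.
by rewrite nth_nil; apply: Rec_const.
Qed.

Lemma Rec_app3 g n F1 F2 F3 : Rec3 g -> Rec n F1 -> Rec n F2 -> Rec n F3 ->
  Rec n (fun v => g (F1 v) (F2 v) (F3 v)).
Proof.
move=> Rg R1 R2 R3.
apply: (Rec_comp (h := [:: F1; F2; F3]) Rg) => // -[|[|[|i]]] //=.
by rewrite nth_nil; apply: Rec_const.
Qed.

Lemma Rec_app4 g n F1 F2 F3 F4 : Rec4 g ->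
  Rec n F1 -> Rec n F2 -> Rec n F3 -> Rec n F4 ->
  Rec n (fun v => g (F1 v) (F2 v) (F3 v) (F4 v)).
Proof.
move=> Rg R1 R2 R3 R4.
apply: (Rec_comp (h := [:: F1; F2; F3; F4]) Rg) => // -[|[|[|[|i]]]] //=.
by rewrite nth_nil; apply: Rec_const.
Qed.

Fixpoint prec N (g : nat) (h : nat -> nat -> nat) : nat :=
  if N is x.+1 then h x (prec x g h) else g.

Lemma Rec_prec n N g h : Rec n N -> Rec n g ->
  Rec n.+2 (fun u => h (nth 0 u 0) (nth 0 u 1) (drop 2 u)) ->
  Rec n (fun v => prec (N v) (g v) (fun x r => h x r v)).
Proof.
move=> RN Rg Rh.
have Rp : Rec n.+1 (fun u => prec (head 0 u) (g (behead u)) (fun x r => h x r (behead u))).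
  apply: (rec_prim Rg Rh) => [v|x v] //=.
  by rewrite drop0.
pose xs := N :: [seq (fun v : seq nat => nth 0 v i) | i <- iota 0 n].
apply: Rec_ext (Rec_comp (h := xs) Rp _ _) _.
- by rewrite /= size_map size_iota.
- case=> // i; rewrite /xs [nth _ _ _]/=.
  have [im|ni] := ltnP i n; last first.
    by rewrite nth_default ?size_map ?size_iota //; apply: Rec_const.
  by rewrite (nth_map 0) ?size_iota // nth_iota //; apply: Rec_nth.
- move=> v sv /=; rewrite -map_comp.
  suff -> : [seq nth 0 v i | i <- iota 0 n] = v by [].
  by rewrite -sv; exact: mkseq_nth.
Qed.

Lemma Rec1_succ : Rec1 S.
Proof.
apply: (rec_comp rec_succ (h := fun _ (v : 1.-tuple nat) => nth 0 v 0)) => [i|v].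
  exact: Rec_nth.
by rewrite tnth_mktuple.
Qed.

Lemma Rec2_add : Rec2 addn.
Proof.
apply: (@Rec_ext _ (fun v => prec (nth 0 v 1) (nth 0 v 0) (fun _ r => r.+1))).
  apply: Rec_prec; try exact: Rec_nth.
  apply: (Rec_app1 Rec1_succ); exact: Rec_nth.
by move=> v _; elim: (nth 0 v 1) => [|y /= ->]; rewrite ?addn0 ?addnS.
Qed.

Definition bsum N (F : nat -> nat) := \sum_(i < N) F i.

Lemma Rec_sum n N F : Rec n N -> Rec n.+1 (fun u => F (nth 0 u 0) (drop 1 u)) ->
  Rec n (fun v => bsum (N v) (F^~ v)).
Proof.
move=> RN RF; apply: (@Rec_ext _ (fun v => prec (N v) 0 (fun i r => r + F i v))).
  apply: Rec_prec => //; first exact: Rec_const.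
  apply: (Rec_app2 Rec2_add); first exact: Rec_nth.
  (* The recursion body receives the index, the accumulator and then the context; these projections
     skip the accumulator at position 1. *)
  pose xs := [seq (fun v : seq nat => nth 0 v (if i is j.+1 then j.+2 else 0)) | i <- iota 0 n.+1].
  apply: Rec_ext (Rec_comp (h := xs) RF _ _) _.
  - by rewrite /= size_map size_iota.
  - move=> i; have [im|ni] := ltnP i n.+1; last first.
      by rewrite nth_default ?size_map ?size_iota //; apply: Rec_const.
    by rewrite (nth_map 0) ?size_iota // nth_iota //; apply: Rec_nth.
  - move=> v sv /=; rewrite -map_comp drop0; congr F.
    have sd : size (drop 2 v) = n by rewrite size_drop sv subn2.
    rewrite (iotaDl 1 0) -map_comp -[RHS](mkseq_nth 0) sd; apply: eq_map => i /=.
    by rewrite nth_drop.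
move=> v _; elim: (N v) => [|N' /= ->]; first by rewrite /bsum big_ord0.
by rewrite /bsum big_ord_recr.
Qed.

Create HintDb rec.
#[global] Hint Resolve Rec1_succ Rec2_add : rec.

Ltac rec_drop := repeat first [exact is_drop_id | apply is_drop_drop].

Ltac rec_step :=
  match goal with
  | |- Rec _ (fun _ => ?c) => exact (Rec_const _ c)
  | |- Rec ?n (fun v => nth 0 v ?i) => exact (Rec_nth n i)
  | |- Rec _ (fun v => nth 0 (@?D v) ?i) => apply (@Rec_var _ D i); rec_drop
  | |- Rec _ (fun v => bsum (@?N v) (@?F v)) =>
      apply (@Rec_sum _ N (fun i v => F v i)); cbv beta
  | |- Rec _ (fun v => prec (@?N v) (@?g v) (@?h v)) =>
      apply (@Rec_prec _ N g (fun x r v => h v x r)); cbv beta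
  | |- Rec _ (fun v => ?g (@?F1 v) (@?F2 v) (@?F3 v) (@?F4 v)) =>
      apply (@Rec_app4 g _ F1 F2 F3 F4); [solve [auto with rec nocore] | cbv beta..]
  | |- Rec _ (fun v => ?g (@?F1 v) (@?F2 v) (@?F3 v)) =>
      apply (@Rec_app3 g _ F1 F2 F3); [solve [auto with rec nocore] | cbv beta..]
  | |- Rec _ (fun v => ?g (@?F1 v) (@?F2 v)) =>
      apply (@Rec_app2 g _ F1 F2); [solve [auto with rec nocore] | cbv beta..]
  | |- Rec _ (fun v => ?g (@?F v)) =>
      apply (@Rec_app1 g _ F); [solve [auto with rec nocore] | cbv beta]
  end.

Ltac rec := cbv beta; repeat rec_step.

Lemma Rec2_mul : Rec2 muln.
Proof.
apply: (@Rec_ext _ (fun v => prec (nth 0 v 1) 0 (fun _ r => nth 0 v 0 + r))); first rec.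
by move=> v _; elim: (nth 0 v 1) => [|y /= ->]; rewrite ?muln0 ?mulnS.
Qed.
#[global] Hint Resolve Rec2_mul : rec.

Lemma Rec2_exp : Rec2 expn.
Proof.
apply: (@Rec_ext _ (fun v => prec (nth 0 v 1) 1 (fun _ r => nth 0 v 0 * r))); first rec.
by move=> v _; elim: (nth 0 v 1) => [|y /= ->]; rewrite ?expn0 ?expnS.
Qed.
#[global] Hint Resolve Rec2_exp : rec.

Lemma Rec1_pred : Rec1 predn.
Proof.
apply: (@Rec_ext _ (fun v => prec (nth 0 v 0) 0 (fun x _ => x))); first rec.
by move=> v _; case: (nth 0 v 0).
Qed.
#[global] Hint Resolve Rec1_pred : rec.

Lemma Rec2_sub : Rec2 subn.
Proof.
apply: (@Rec_ext _ (fun v => prec (nth 0 v 1) (nth 0 v 0) (fun _ r => r.-1))); first rec.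
by move=> v _; elim: (nth 0 v 1) => [|y /= ->]; rewrite ?subn0 ?subnS.
Qed.
#[global] Hint Resolve Rec2_sub : rec.

Lemma Rec2_leq : Rec2 (fun x y => x <= y : nat).
Proof.
apply: (@Rec_ext _ (fun v => 1 - (nth 0 v 0 - nth 0 v 1))); first rec.
by move=> v _; rewrite /leq; case: (nth 0 v 0 - nth 0 v 1).
Qed.
#[global] Hint Resolve Rec2_leq : rec.

Definition BRec n (P : seq nat -> bool) := Rec n (fun v => P v : nat).

Lemma BRec_leq n F G : Rec n F -> Rec n G -> BRec n (fun v => F v <= G v).
Proof. exact: Rec_app2 Rec2_leq. Qed.

Lemma BRec_and n P P' : BRec n P -> BRec n P' -> BRec n (fun v => P v && P' v).
Proof.
move=> RP RP'; apply: Rec_ext (Rec_app2 Rec2_mul RP RP') _ => v _.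
by rewrite mulnb.
Qed.

Lemma BRec_neg n P : BRec n P -> BRec n (fun v => ~~ P v).
Proof.
move=> RP; apply: Rec_ext (Rec_app2 Rec2_sub (Rec_const _ 1) RP) _ => v _.
by case: (P v).
Qed.

Lemma BRec_or n P P' : BRec n P -> BRec n P' -> BRec n (fun v => P v || P' v).
Proof.
move=> /BRec_neg RP /BRec_neg RP'.
apply: Rec_ext (BRec_neg (BRec_and RP RP')) _ => v _.
by rewrite negb_and !negbK.
Qed.

Lemma BRec_eq n F G : Rec n F -> Rec n G -> BRec n (fun v => F v == G v).
Proof.
move=> RF RG; apply: Rec_ext (BRec_and (BRec_leq RF RG) (BRec_leq RG RF)) _ => v _.
by rewrite eqn_leq.
Qed.

Lemma BRec_has n N P : Rec n N -> BRec n.+1 (fun u => P (nth 0 u 0) (drop 1 u)) ->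
  BRec n (fun v => has (fun i => P i v) (iota 0 (N v))).
Proof.
move=> RN RP; have RS := @Rec_sum _ _ (fun i v => P i v) RN RP.
apply: Rec_ext (BRec_leq (Rec_const _ 1) RS) _ => v _; congr nat_of_bool.
rewrite lt0n sum_nat_eq0 negb_forall; apply/existsP/hasP => [[i Pi]|[i]].
  by exists (i : nat); [rewrite mem_iota /= | move: Pi; case: (P i v)].
by rewrite mem_iota /= => iN Pi; exists (Ordinal iN); rewrite /= Pi.
Qed.

Lemma BRec_all n N P : Rec n N -> BRec n.+1 (fun u => P (nth 0 u 0) (drop 1 u)) ->
  BRec n (fun v => all (fun i => P i v) (iota 0 (N v))).
Proof.
move=> RN /BRec_neg RP; apply: Rec_ext (BRec_neg (BRec_has (P := fun i v => ~~ P i v) RN RP)) _.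
move=> v _; congr nat_of_bool; rewrite -all_predC; apply: eq_all => i /=.
exact: negbK.
Qed.

Lemma BRec_has_seq n (I : Type) (r : seq I) P : (forall i, BRec n (P i)) ->
  BRec n (fun v => has (fun i => P i v) r).
Proof.
move=> RP; elim: r => [|i r IH]; first exact: Rec_const.
exact: BRec_or.
Qed.

Lemma Rec_if n P F G : BRec n P -> Rec n F -> Rec n G ->
  Rec n (fun v => if P v then F v else G v).
Proof.
move=> RP RF RG; have RP' := BRec_neg RP.
apply: Rec_ext (Rec_app2 Rec2_add (Rec_app2 Rec2_mul RP RF) (Rec_app2 Rec2_mul RP' RG)) _.
by move=> v _; case: (P v); rewrite mul1n mul0n ?addn0.
Qed.

Ltac brec_step :=
  match goal with
  | |- Rec _ (fun v => nat_of_bool (@?P v)) => change (BRec _ P)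
  | |- BRec _ (fun v => (@?F v) <= (@?G v)) => apply (@BRec_leq _ F G); cbv beta
  | |- BRec _ (fun v => (@?F v) == (@?G v)) => apply (@BRec_eq _ F G); cbv beta
  | |- BRec _ (fun v => (@?F v) && (@?G v)) => apply (@BRec_and _ F G); cbv beta
  | |- BRec _ (fun v => (@?F v) || (@?G v)) => apply (@BRec_or _ F G); cbv beta
  | |- BRec _ (fun v => has (@?P v) (iota 0 (@?N v))) =>
      apply (@BRec_has _ N (fun i v => P v i)); cbv beta
  | |- BRec _ (fun v => all (@?P v) (iota 0 (@?N v))) =>
      apply (@BRec_all _ N (fun i v => P v i)); cbv beta
  | |- _ => rec_step
  | |- Rec _ _ => apply Rec_if
  end.

Ltac brec := cbv beta; repeat brec_step.

(** The quotient counts the positive multiples of the divisor up to the dividend. The test for a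
    positive divisor matches the convention that division by 0 gives 0. *)
Lemma Rec2_div : Rec2 divn.
Proof.
apply: (@Rec_ext _ (fun v => bsum (nth 0 v 0) (fun i =>
  (0 < nth 0 v 1) && (i.+1 * nth 0 v 1 <= nth 0 v 0)))); first brec.
move=> v _; rewrite /bsum; move: (nth 0 v 0) (nth 0 v 1) => x [|y].
  by rewrite big1 // divn0.
rewrite -[RHS](@subnK 0) // addn0 -[LHS]addn0; symmetry.
transitivity (\sum_(i < x) (i < x %/ y.+1 : nat)).
  have := leq_div x y.+1; move: (x %/ y.+1) => q.
  elim: x q => [|x IH] q; first by rewrite leqn0 => /eqP->; rewrite big_ord0.
  rewrite leq_eqVlt => /orP[/eqP->|qx]; rewrite subn0.
    rewrite (eq_bigr (fun=> 1)) => [|i _]; last by rewrite ltn_ord.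
    by rewrite sum1_card card_ord.
  by rewrite big_ord_recr /= -IH // subn0 ltnNge -ltnS qx addn0.
rewrite addn0; apply: eq_bigr => i _; congr nat_of_bool.
by rewrite /= leq_divRL.
Qed.
#[global] Hint Resolve Rec2_div : rec.

Lemma Rec2_mod : Rec2 modn.
Proof.
apply: (@Rec_ext _ (fun v => nth 0 v 0 - nth 0 v 0 %/ nth 0 v 1 * nth 0 v 1)); first brec.
by move=> v _; rewrite {1}(divn_eq (nth 0 v 0) (nth 0 v 1)) addKn.
Qed.
#[global] Hint Resolve Rec2_mod : rec.

Lemma Rec2_pair_code : Rec2 pair_code.
Proof.
apply: (@Rec_ext _ (fun v => bsum (nth 0 v 0 + nth 0 v 1).+1 id + nth 0 v 1)).
  brec.
by move=> v _; rewrite /pair_code -bin2_sum big_mkord.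
Qed.
#[global] Hint Resolve Rec2_pair_code : rec.

(** Codes on the diagonal [x + y = s] stay below those of the next diagonal, so a code determines
    first the sum and then [y]. *)
Lemma pair_code_inj x y x' y' : pair_code x y = pair_code x' y' -> x = x' /\ y = y'.
Proof.
have lt a b a' b' : a + b < a' + b' -> pair_code a b < pair_code a' b'.
  move=> ab; rewrite /pair_code; apply: (@leq_trans ('C((a + b).+2, 2))).
    by rewrite [X in _ < X]binS bin1 ltn_add2l ltnS leq_addl.
  by apply: leq_trans (leq_addr _ _); rewrite leq_bin2l.
move=> E; have s : x + y = x' + y'.
  by case: (ltngtP (x + y) (x' + y')) => // /lt; rewrite E ltnn.
move: E; rewrite /pair_code s => /addnI E; split=> //.
by apply/eqP; rewrite -(eqn_add2r y) s E.
Qed.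

(** Inverts the pairing by exhaustive search: both components are at most the code, and injectivity
    leaves one nonzero indicator. *)
Definition unpair_left n :=
  bsum n.+1 (fun x => bsum n.+1 (fun y => x * (pair_code x y == n))).

Definition unpair_right n :=
  bsum n.+1 (fun x => bsum n.+1 (fun y => y * (pair_code x y == n))).

Lemma unpair_sum (F : nat -> nat -> nat) a b (n := pair_code a b) :
  \sum_(x < n.+1) \sum_(y < n.+1) F x y * (pair_code x y == n) = F a b.
Proof.
have an : a < n.+1 by rewrite ltnS leq_pair_codel.
have bn : b < n.+1 by rewrite ltnS leq_pair_coder.
rewrite (bigD1 (Ordinal an)) //= [X in _ + X]big1 => [|x xa].
  rewrite (bigD1 (Ordinal bn)) //= eqxx muln1 big1 ?addn0 // => y yb.
  case: eqP => [/pair_code_inj[_ /= E]|]; last by rewrite muln0.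
  by case/eqP: yb; apply: val_inj.
rewrite big1 // => y _; case: eqP => [/pair_code_inj[/= E _]|]; last by rewrite muln0.
by case/eqP: xa; apply: val_inj.
Qed.

Lemma unpair_leftK a b : unpair_left (pair_code a b) = a.
Proof. exact: (@unpair_sum (fun x _ => x)). Qed.

Lemma unpair_rightK a b : unpair_right (pair_code a b) = b.
Proof. exact: (@unpair_sum (fun _ y => y)). Qed.

Lemma Rec1_unpair_left : Rec1 unpair_left.
Proof. rewrite /Rec1 /unpair_left; brec. Qed.

Lemma Rec1_unpair_right : Rec1 unpair_right.
Proof. rewrite /Rec1 /unpair_right; brec. Qed.

Lemma Rec3_digit : Rec3 digit.
Proof. rewrite /Rec3 /digit; brec. Qed.
#[global] Hint Resolve Rec1_unpair_left Rec1_unpair_right Rec3_digit : rec.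

Lemma Rec_bitmask n N P : Rec n N -> BRec n.+1 (fun u => P (nth 0 u 0) (drop 1 u)) ->
  Rec n (fun v => bitmask (N v) (P^~ v)).
Proof.
move=> RN RP; apply: (@Rec_sum _ _ (fun i v => P i v * 2 ^ i)) => //.
by apply: (Rec_app2 Rec2_mul RP); rec.
Qed.

Lemma BRec_bit n F G : Rec n F -> Rec n G -> BRec n (fun v => bit (F v) (G v)).
Proof. by move=> RF RG; apply: BRec_eq; [apply: Rec_app3 => //|]; rec; auto with rec. Qed.

Ltac trec_step :=
  match goal with
  | |- Rec _ (fun v => bitmask (@?N v) (@?P v)) =>
      apply (@Rec_bitmask _ N (fun i v => P v i)); cbv beta
  | |- BRec _ (fun v => bit (@?F v) (@?G v)) => apply (@BRec_bit _ F G); cbv beta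
  | |- _ => brec_step
  end.

Ltac trec := cbv beta; repeat trec_step.

(** * The decision procedure *)

(* A relation on the numbers below [M] is stored in the bits below [M * M]. *)
Definition table_of M (R : nat -> nat -> Prop) :=
  bitmask (M * M) (fun i => `[< R (i %/ M) (i %% M) >]).

Definition table_one M := bitmask (M * M) (fun i => i %/ M == i %% M).

Definition table_sum M a b := bitmask (M * M) (fun i => bit a i || bit b i).

Definition table_dot M a b := bitmask (M * M) (fun i =>
  has (fun j => bit a (i %/ M * M + j) && bit b (j * M + i %% M)) (iota 0 M)).

(** Iterates [1 + a * r] from the empty relation: [M] rounds give the paths with fewer than [M]
    edges, enough among [M] points. *)
Definition table_star M a :=
  prec M 0 (fun _ r => table_sum M (table_one M) (table_dot M a r)).

Lemma Rec1_table_one : Rec1 table_one.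
Proof. rewrite /Rec1 /table_one; trec. Qed.

Lemma Rec3_table_sum : Rec3 table_sum.
Proof. rewrite /Rec3 /table_sum; trec. Qed.

Lemma Rec3_table_dot : Rec3 table_dot.
Proof. rewrite /Rec3 /table_dot; trec. Qed.
#[global] Hint Resolve Rec1_table_one Rec3_table_sum Rec3_table_dot : rec.

Lemma Rec2_table_star : Rec2 table_star.
Proof. rewrite /Rec2 /table_star; trec. Qed.
#[global] Hint Resolve Rec2_table_star : rec.

Lemma eq_table_of M R R' :
  (forall s t, s < M -> t < M -> R s t <-> R' s t) -> table_of M R = table_of M R'.
Proof.
move=> RR; apply: eq_bitmask => i; case: M RR => // M RR iM.
by apply: asbool_equiv_eq; apply: RR; rewrite ?ltn_mod // ltn_divLR.
Qed.

Lemma bit_table_of M R s t : s < M -> t < M -> bit (table_of M R) (s * M + t) = `[< R s t >].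
Proof.
move=> sM tM; have M0 : 0 < M by apply: leq_ltn_trans sM.
rewrite bit_bitmask; last first.
  apply: (@leq_trans (s.+1 * M)); first by rewrite mulSn addnC ltn_add2r.
  by rewrite leq_mul2r sM orbT.
by rewrite divnMDl // divn_small // addn0 modnMDl modn_small.
Qed.

Lemma table_of_inj M R R' : table_of M R = table_of M R' ->
  forall s t, s < M -> t < M -> R s t <-> R' s t.
Proof.
move=> E s t sM tM; apply: asbool_eq_equiv.
rewrite -(bit_table_of R sM tM) -(bit_table_of R' sM tM).
exact: (congr1 (bit^~ _) E).
Qed.

Lemma table_zeroE M : 0 = table_of M (fun _ _ => False).
Proof. by rewrite /table_of /bitmask /collect big1 // => i _; rewrite asboolF. Qed.

Lemma table_oneE M : table_one M = table_of M eq.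
Proof. by apply: eq_bitmask => i _; apply/eqP/asboolP. Qed.

Lemma table_sumE M R R' : table_sum M (table_of M R) (table_of M R') =
  table_of M (fun s t => R s t \/ R' s t).
Proof.
apply: eq_bitmask => i iM; rewrite !bit_bitmask //.
by apply/orP/asboolP => -[/asboolP|/asboolP]; [left|right|left|right].
Qed.

Lemma table_dotE M R R' : (forall s t, R s t -> s < M -> t < M) ->
  table_dot M (table_of M R) (table_of M R') =
  table_of M (fun s t => exists2 u, R s u & R' u t).
Proof.
move=> RM; apply: eq_bitmask => i; case: M RM => // M RM iM.
have sM : i %/ M.+1 < M.+1 by rewrite ltn_divLR.
have tM : i %% M.+1 < M.+1 by rewrite ltn_mod.
apply/hasP/asboolP => [[j]|[u Ru R'u]].
  rewrite mem_iota /= => jM /andP[].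
  by rewrite !bit_table_of // => /asboolP Rj /asboolP R'j; exists j.
have uM := RM _ _ Ru sM.
by exists u; rewrite ?mem_iota // !bit_table_of //; apply/andP; split; apply/asboolP.
Qed.

Lemma table_starE M R : (forall s t, R s t -> s < M -> t < M) ->
  table_star M (table_of M R) = table_of M (rtc R).
Proof.
move=> RM; pose e (s t : nat) := `[< R s t >].
pose short n s t := exists p, [/\ size p < n, path e s p & t = last s p].
rewrite /table_star.
have -> : forall n, prec n 0 (fun _ r => table_sum M (table_one M) (table_dot M (table_of M R) r))
    = table_of M (short n).
  elim=> [|n IH] /=.
    by apply: etrans (table_zeroE M) (eq_table_of _) => s t _ _; split=> // -[p []].
  rewrite IH table_dotE // table_oneE table_sumE; apply: eq_table_of => s t _ _.
  split=> [[->|[u Ru [p [pn ep ->]]]]|[[|u p] [pn /= ep ->]]].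
  - by exists [::].
  - by exists (u :: p); split=> //=; apply/andP; split=> //; apply/asboolP.
  - by left.
  - by case/andP: ep => /asboolP Ru ep; right; exists u => //; exists p.
apply: eq_table_of => s t sM _; split=> [[p [_ ep ->]]|st].
  elim: p s {sM} ep => [|u p IH] s /=; first by move=> _; apply: rtc_refl.
  by case/andP => /asboolP Ru /IH; apply: rtc_step.
have [p0 ep0 ->] : exists2 p, path e s p & t = last s p.
  elim: st => [u|r u w Ru _ [p ep ->]]; first by exists [::].
  by exists (u :: p) => //=; apply/andP; split=> //; apply/asboolP.
(* A path without repetition visits distinct points below [M], hence has fewer than [M] edges. *)
case/shortenP: ep0 {st} => p ep up _; exists p; split=> //.
rewrite -[_.+1]/(size (s :: p)) -(size_iota 0 M); apply: uniq_leq_size => // u.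
rewrite mem_iota /= add0n inE => /orP[/eqP-> //|].
elim: p s sM ep {up} => // x p IH s sM /= /andP[/asboolP Rx ep].
have xM := RM _ _ Rx sM.
by rewrite inE => /orP[/eqP-> //|]; apply: (IH x).
Qed.

(** * Evaluating terms by tables and comparing the results *)

Section Tables.
Variable A : finType.
Notation k := #|A|.
Notation points m := (m * k).

Definition table_letter m c (j : nat) := bitmask (points m * points m) (fun i =>
  has (fun x => (j == enum_rank x :> nat) &&
    table_model m c x (i %/ points m) (i %% points m)) (enum (netkat_letter A))).

(* [h] lists the tables of the codes below [n], in base [2 ^ (M * M)]. *)
Definition table_step m c h n :=
  let M := points m in
  let V := 2 ^ (M * M) in
  let tag := unpair_left n in
  let arg := unpair_right n in
  let arg1 := unpair_left arg in
  let arg2 := unpair_right arg in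
  if tag == 1 then table_one M
  else if tag == 2 then table_letter m c arg
  else if tag == 3 then table_sum M (digit V h arg1) (digit V h arg2)
  else if tag == 4 then table_dot M (digit V h arg1) (digit V h arg2)
  else if tag == 5 then table_star M (digit V h arg)
  else 0.

Definition table_history m c n := prec n 0 (fun i h =>
  h + table_step m c h i * (2 ^ (points m * points m)) ^ i).

Definition table m c n := table_step m c (table_history m c n) n.

Lemma BRec_table_model n m c (x : netkat_letter A) s t :
  Rec n m -> Rec n c -> Rec n s -> Rec n t ->
  BRec n (fun v => table_model (m v) (c v) x (s v) (t v)).
Proof.
by move=> Rm Rc Rs Rt; case: x => [[a|a]|u]; rewrite /table_model; do !(trec; try assumption).
Qed.

(** The alphabet is a fixed finite list, so the search over letters is a finite disjunction with the
    ranks as constants. *)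
Lemma Rec3_table_letter : Rec3 table_letter.
Proof.
rewrite /Rec3 /table_letter; trec; apply BRec_has_seq => x; trec.
by apply BRec_table_model; trec.
Qed.
Hint Resolve Rec3_table_letter : rec.

Lemma Rec4_table_step : Rec4 table_step.
Proof. rewrite /Rec4 /table_step; trec. Qed.
Hint Resolve Rec4_table_step : rec.

Lemma Rec3_table : Rec3 table.
Proof. rewrite /Rec3 /table /table_history; trec. Qed.

(** Each table fits in one digit of the history. For the star, the case without points is apart: its
    recursion then returns 0 at once. *)
Lemma table_lt m c n : table m c n < 2 ^ (points m * points m).
Proof.
have star_lt a : table_star (points m) a < 2 ^ (points m * points m).
  by rewrite /table_star; case: (points m) => [|M] //=; apply: bitmask_lt.
by rewrite /table /table_step; do 5![case: ifP => _; first by [exact: bitmask_lt|]];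
  rewrite expn_gt0.
Qed.

Lemma table_historyE m c n i : i < n ->
  digit (2 ^ (points m * points m)) (table_history m c n) i = table m c i.
Proof.
move=> ilt; have -> : table_history m c n =
    collect (2 ^ (points m * points m)) n (table m c).
  elim: n {ilt} => [|n IH]; first by rewrite /collect big_ord0.
  by rewrite /collect big_ord_recr /= -/(collect _ n (table m c)) -IH.
by apply: digit_collect => // j _; apply: table_lt.
Qed.

(** Composite terms have positive tags, so the codes of their subterms are strictly smaller and
    their tables can be read off the history. *)
Lemma table_correct m c (e : term (netkat_letter A)) :
  table m c (term_code e) = table_of (points m) (eval (table_model m c) e).
Proof.
have RM e' s t := @table_model_lt A m c e' s t.
elim: e => [||x|e IHe f IHf|e IHe f IHf|e IHe] /=;
  rewrite /table /table_step unpair_leftK unpair_rightK /=;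
  rewrite ?unpair_leftK ?unpair_rightK ?table_historyE.
- exact: table_zeroE.
- exact: table_oneE.
- apply: eq_bitmask => i _; apply/hasP/asboolP => [[y _ /andP[/eqP/ord_inj/enum_rank_inj->]] //|xi].
  by exists x; rewrite ?mem_enum // eqxx.
- by rewrite IHe IHf table_sumE.
- exact: leq_ltn_trans (leq_pair_coder _ _) (ltn_pair_coder _ _).
- exact: leq_ltn_trans (leq_pair_codel _ _) (ltn_pair_coder _ _).
- by rewrite IHe IHf table_dotE //; apply: RM.
- exact: leq_ltn_trans (leq_pair_coder _ _) (ltn_pair_coder _ _).
- exact: leq_ltn_trans (leq_pair_codel _ _) (ltn_pair_coder _ _).
- by rewrite IHe table_starE //; apply: RM.
- exact: ltn_pair_coder.
Qed.

(** With [m] states, [k * m * m] bits describe every possible effect of [dup], so the search over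
    [c] exhausts the models of that size. *)
Definition netkat_decide x y : nat :=
  all (fun c => table (word_bound A x y) c x == table (word_bound A x y) c y)
    (iota 0 (2 ^ (k * word_bound A x y * word_bound A x y))).

Lemma Rec2_netkat_decide : Rec2 netkat_decide.
Proof.
have R3 := Rec3_table; rewrite /Rec2 /netkat_decide /word_bound.
do !(trec; first [apply: (Rec_app3 R3) | idtac]).
Qed.

Lemma netkat_decidable : decidable_relation (ka_eq (H_netkat A)).
Proof.
exists (fun v : 2.-tuple nat => netkat_decide (nth 0 v 0) (nth 0 v 1)).
split=> [|e f]; first exact: Rec2_netkat_decide.
rewrite /netkat_decide /=; set m := word_bound A _ _.
split=> [ef|/eqP].
  suff -> : all (fun c => table m c (term_code e) == table m c (term_code f))
    (iota 0 (2 ^ (k * m * m))) by [].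
  apply/allP => c _; rewrite !table_correct; apply/eqP/eq_table_of => s t.
  move=> /renumberP[p _ ->] /renumberP[q _ ->]; rewrite !eval_renumber.
  exact: coded_models_sound.
rewrite eqb1 => /allP eqt; apply: (@coded_models_complete A e f m) => // c cb s t sm.
have := eqt c; rewrite mem_iota /= add0n => /(_ cb) /eqP.
rewrite !table_correct => E; have teq := table_of_inj E; rewrite -!eval_renumber.
have rs := renumber_lt sm.
(* Equal tables speak only about points below [m * k]; a target reached from such a point is again
   one. *)
split=> st; apply/teq => //; exact: table_model_lt st rs.
Qed.

End Tables.

Theorem theorem10p8 (A : finType) :
  reduces_to_empty (H_netkat A)
  /\ ka_complete (H_netkat A)
  /\ decidable_relation (ka_eq (H_netkat A)).
Proof.
split; first exact: netkat_reduces.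
by split; [apply: netkat_complete | apply: netkat_decidable].
Qed.
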